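(* Consider the discrete Stokes problem with data $\boldsymbol{f}\in[L^2(\Omega)]^d$: find $(\boldsymbol{u}_h,p_h)\in V_h\times W_h$ such that $$\nu a_h(\boldsymbol{u}_h,\boldsymbol{v}_h)-b(\boldsymbol{v}_h,p_h)=(\boldsymbol{f},\boldsymbol{v}_h)\quad\forall\,\boldsymbol{v}_h\in V_h,\qquad b(\boldsymbol{u}_h,q_h)=0\quad\forall\, q_h\in W_h,$$ where $V_h=V_h^1\oplus RT0$ and $a^R$ (entering $a_h$) is any of the three choices $a^0,a^D,a^{\operatorname{div}}$. Let $\psi\in H^1(\Omega)/\mathbb{R}$ (identified with its zero-mean representative). If $(\boldsymbol{u}_h,p_h)$ is the solution for the data $\boldsymbol{f}$, then the solution for the data $\boldsymbol{f}+\nabla\psi$ is $(\boldsymbol{u}_h,p_h+P_h\psi)$, where $P_h:W\to W_h$ is the $L^2$ projection.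
   Context: $\Omega\subset\mathbb{R}^d$ ($d=2,3$) is a bounded domain with Lipschitz polygonal/polyhedral boundary $\Gamma$; $\nu>0$ is a constant; $(\cdot,\cdot)$, $(\cdot,\cdot)_T$ are the $L^2$ inner products on $\Omega$, $T$. $\mathcal{T}_h$ is a shape-regular conforming triangulation of $\Omega$ into triangles/tetrahedra; $h_T$ is the diameter of $T$; $\mathcal{E}^0$ is the set of interior faces. Spaces: $V=[H_0^1(\Omega)]^d$, $W=L_0^2(\Omega)$ (zero-mean $L^2$ functions), $V_h^1=\{\boldsymbol{v}\in V:\boldsymbol{v}|_T\in[P_1(T)]^d\ \forall T\in\mathcal{T}_h\}$, $RT0=\{\boldsymbol{v}\in H_0(\operatorname{div};\Omega):\boldsymbol{v}|_T\in[P_0(T)]^d\oplus\boldsymbol{x}P_0(T)\ \forall T\in\mathcal{T}_h\}$, $W_h=\{q\in L_0^2(\Omega):q|_T\in P_0(T)\ \forall T\in\mathcal{T}_h\}$, where $H_0(\operatorname{div};\Omega)$ is the space of $\boldsymbol v\in [L^2(\Omega)]^d$ with $\nabla\cdot\boldsymbol v\in L^2(\Omega)$ and $\boldsymbol v\cdot\boldsymbol n|_\Gamma=0$. One has $V_h^1\cap RT0=\{\boldsymbol 0\}$, and $V_h=V_h^1\oplus RT0$. For $e\in\mathcal{E}^0$, $\boldsymbol{\Phi}_e\in RT0$ is the usual basis function, supported on the two elements sharing $e$, with $\boldsymbol{\Phi}_e\cdot\boldsymbol{n}_{e'}=0$ on every face $e'\ne e$ (its nonzero normalization is immaterial). Each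 $\boldsymbol{v}_h\in V_h$ is uniquely written $\boldsymbol{v}_h=\boldsymbol{v}_h^1+\boldsymbol{v}_h^R$ with $\boldsymbol{v}_h^1\in V_h^1$, $\boldsymbol{v}_h^R=\sum_{e\in\mathcal{E}^0}v_e\boldsymbol{\Phi}_e\in RT0$. Forms: $a(\boldsymbol{u},\boldsymbol{v})=(\nabla\boldsymbol{u},\nabla\boldsymbol{v})$, $b(\boldsymbol{v},q)=(\nabla\cdot\boldsymbol{v},q)$, $a_h(\boldsymbol{u}_h,\boldsymbol{v}_h)=a(\boldsymbol{u}_h^1,\boldsymbol{v}_h^1)+a^R(\boldsymbol{u}_h^R,\boldsymbol{v}_h^R)$, where, with positive parameters $\alpha_T$ ($T\in\mathcal{T}_h$), $a^R$ is one of $a^0(\boldsymbol{u}^R,\boldsymbol{v}^R)=\sum_{T}\alpha_Th_T^{-2}(\boldsymbol{u}^R,\boldsymbol{v}^R)_T$, $a^D(\boldsymbol{u}^R,\boldsymbol{v}^R)=\sum_T\sum_{e\subset\partial T,\,e\in\mathcal{E}^0}\alpha_Th_T^{-2}u_ev_e(\boldsymbol{\Phi}_e,\boldsymbol{\Phi}_e)_T$, $a^{\operatorname{div}}(\boldsymbol{u}^R,\boldsymbol{v}^R)=\sum_T\sum_{e\subset\partial T,\,e\in\mathcal{E}^0}\alpha_Tu_ev_e(\nabla\cdot\boldsymbol{\Phi}_e,\nabla\cdot\boldsymbol{\Phi}_e)_T$. $P_h:W\to W_h$ is defined by $(r-P_hr,q)=0$ for all $q\in W_h$. *)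

(* Defs.v *)
From HB Require Import structures.
From mathcomp Require Import all_boot all_order all_algebra.
From mathcomp Require Import all_classical all_reals all_analysis.

Set Implicit Arguments.
Unset Strict Implicit.
Unset Printing Implicit Defensive.

Import Order.TTheory GRing.Theory Num.Theory.
Import numFieldNormedType.Exports.

Local Open Scope classical_set_scope.
Local Open Scope ring_scope.

(** * Lebesgue measure on [R^n] *)

Section row_measurable.
Context {R : realType} (n : nat).

Let coors : 'I_n -> 'rV[R]_n -> R := fun i x => x ord0 i.

Let row_set0 : g_sigma_preimage coors set0.
Proof. exact: sigma_algebra0. Qed.

Let row_setC A : g_sigma_preimage coors A -> g_sigma_preimage coors (~` A).
Proof. exact: sigma_algebraC. Qed.

Let row_bigcup (F : (set 'rV[R]_n)^nat) :
  (forall i, g_sigma_preimage coors (F i)) ->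
  g_sigma_preimage coors (\bigcup_i (F i)).
Proof. exact: sigma_algebra_bigcup. Qed.

HB.instance Definition _ := @isMeasurable.Build default_measure_display
  'rV[R]_n (g_sigma_preimage coors) row_set0 row_setC row_bigcup.

Lemma measurable_coord (i : 'I_n) :
  measurable_fun [set: 'rV[R]_n] (fun x : 'rV[R]_n => x ord0 i).
Proof.
move=> _ Y mY; rewrite setTI; apply: sub_sigma_algebra.
rewrite -bigcup_seq/=; exists i => /=; first by rewrite mem_index_enum.
by exists Y => //; rewrite setTI.
Qed.

Lemma measurable_rowP d (T : measurableType d) (f : T -> 'rV[R]_n) :
  (forall i, measurable_fun [set: T] (fun t => f t ord0 i)) ->
  measurable_fun [set: T] f.
Proof.
move=> mf _ A mA; rewrite setTI.
suff : g_sigma_preimage coors `<=` [set B | measurable (f @^-1` B)] by exact.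
apply: smallest_sub.
  split => [|B mB|F mF] /=.
  - by rewrite preimage_set0; exact: measurable0.
  - by rewrite setTD preimage_setC; exact: measurableC.
  - by rewrite preimage_bigcup; exact: bigcupT_measurable.
rewrite -bigcup_seq => B [i _] [Y mY <-]; rewrite setTI /=.
by have := mf i measurableT Y mY; rewrite setTI.
Qed.

End row_measurable.

Section lebesgue_rV.
Context {R : realType}.

Definition cons_row n (p : measurableTypeR R * 'rV[R]_n) : 'rV[R]_n.+1 :=
  \row_i (if unlift ord0 i is Some j then p.2 ord0 j else p.1).

Definition behead_row n (x : 'rV[R]_n.+1) : measurableTypeR R * 'rV[R]_n :=
  (x ord0 ord0, \row_j x ord0 (lift ord0 j)).

Lemma cons_rowK n : cancel (@cons_row n) (@behead_row n).
Proof.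
case=> a x; rewrite /behead_row /cons_row mxE unlift_none; congr pair.
by apply/rowP => j; rewrite !mxE liftK.
Qed.

Lemma measurable_cons_row n :
  measurable_fun [set: measurableTypeR R * 'rV[R]_n] (@cons_row n).
Proof.
apply: measurable_rowP => i; rewrite /cons_row.
case: (unliftP ord0 i) => [j ->|->].
  rewrite (_ : (fun _ => _) = (fun x : 'rV[R]_n => x ord0 j) \o snd).
    by apply: measurableT_comp; [exact: measurable_coord|exact: measurable_snd].
  by apply/funext => p; rewrite mxE liftK.
rewrite (_ : (fun _ => _) = fst); first exact: measurable_fst.
by apply/funext => p; rewrite mxE unlift_none.
Qed.

Lemma measurable_behead_row n :
  measurable_fun [set: 'rV[R]_n.+1] (@behead_row n).
Proof.
apply/measurable_fun_pairP; split; first exact: measurable_coord.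
apply: measurable_rowP => i.
rewrite (_ : (fun _ => _) = fun x : 'rV[R]_n.+1 => x ord0 (lift ord0 i)).
  exact: measurable_coord.
by apply/funext => x; rewrite /= mxE.
Qed.

Section cons_measure.
Local Open Scope ereal_scope.
Context (n : nat) (mu : {sigma_finite_measure set 'rV[R]_n -> \bar R}).

Definition cons_measure : set 'rV[R]_n.+1 -> \bar R :=
  pushforward (@lebesgue_measure R \x mu) (@cons_row n).

Let cons_measure0 : cons_measure set0 = 0.
Proof. by rewrite /cons_measure /pushforward preimage_set0 measure0. Qed.

Let cons_measure_ge0 A : 0 <= cons_measure A.
Proof. exact: (measure_ge0 (@lebesgue_measure R \x mu)). Qed.

Let cons_measure_sigma_additive : semi_sigma_additive cons_measure.
Proof.
move=> F mF tF mUF; rewrite /cons_measure /pushforward preimage_bigcup.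
have mcons := @measurable_cons_row n.
apply: (measure_semi_sigma_additive (s := (@lebesgue_measure R \x mu))%E).
- by move=> k; rewrite -[X in measurable X]setTI; exact: mcons.
- apply/trivIsetP => /= i j _ _ ij; rewrite -preimage_setI.
  by move/trivIsetP : tF => /(_ _ _ _ _ ij) ->//; rewrite preimage_set0.
- by rewrite -preimage_bigcup -[X in measurable X]setTI; exact: mcons.
Qed.

HB.instance Definition _ := isMeasure.Build _ _ _ cons_measure
  cons_measure0 cons_measure_ge0 cons_measure_sigma_additive.

Let cons_measure_sigma_finite : sigma_finite setT cons_measure.
Proof.
have /sigma_finiteP[F [TF ndF Foo]] := sigma_finiteT (@lebesgue_measure R).
have /sigma_finiteP[G [TG ndG Goo]] := sigma_finiteT mu.
exists (fun k => @behead_row n @^-1` (F k `*` G k)).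
  rewrite -preimage_bigcup; apply/seteqP; split=> // x _ /=.
  have [i _ Fi] : (\bigcup_i F i) (behead_row x).1 by rewrite -TF.
  have [j _ Gj] : (\bigcup_j G j) (behead_row x).2 by rewrite -TG.
  exists (maxn i j) => //; split.
  - by move: Fi; exact/subsetPset/ndF/leq_maxl.
  - by move: Gj; exact/subsetPset/ndG/leq_maxr.
move=> k; have [mF Fk] := Foo k; have [mG Gk] := Goo k.
split.
  rewrite -[X in measurable X]setTI; apply: measurable_behead_row => //.
  exact: measurableX.
rewrite /cons_measure /pushforward -comp_preimage.
rewrite (_ : _ \o _ = id) ?preimage_id; last first.
  by apply/funext => p /=; rewrite cons_rowK.
by rewrite product_measure1E// lte_mul_pinfty// ge0_fin_numE.
Qed.

HB.instance Definition _ := Measure_isSigmaFinite.Build _ _ _ cons_measure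
  cons_measure_sigma_finite.

End cons_measure.

Fixpoint lebesgue_rV (n : nat) : {sigma_finite_measure set 'rV[R]_n -> \bar R} :=
  match n with
  | 0%N => \d_(0 : 'rV[R]_0)
  | m.+1 => cons_measure (lebesgue_rV m)
  end.

End lebesgue_rV.

(** * Euclidean geometry *)

Section geometry.
Context {R : realType} {d : nat}.
Implicit Types (x y u v : 'rV[R]_d) (Omega : set 'rV[R]_d).

Definition dot u v : R := \sum_(i < d) u ord0 i * v ord0 i.

(* The norm that MathComp-Analysis puts on ['rV_d] is the max norm. *)
Definition enorm u : R := Num.sqrt (dot u u).

Definition hull (I : finType) (p : I -> 'rV[R]_d) (A : {set I}) :
    set 'rV[R]_d :=
  [set x | exists l : I -> R, [/\ forall i, 0 <= l i,
     forall i, i \notin A -> l i = 0, \sum_i l i = 1 &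
     x = \sum_i l i *: p i]].

Definition affinely_independent (I : finType) (p : I -> 'rV[R]_d)
    (A : {set I}) : Prop :=
  forall l : I -> R, (forall i, i \notin A -> l i = 0) ->
    \sum_i l i = 0 -> \sum_i l i *: p i = 0 -> forall i, l i = 0.

Definition diameter (K : set 'rV[R]_d) : R :=
  sup [set enorm (z.1 - z.2) | z in K `*` K].

Definition indiameter (K : set 'rV[R]_d) : R :=
  sup [set r *+ 2 | r in [set r | 0 <= r /\
    exists c, [set y | enorm (y - c) <= r] `<=` K]].

Definition boundary Omega : set 'rV[R]_d := closure Omega `\` Omega°.

(* Near every boundary point, [Omega] lies on one side of the graph of a
   Lipschitz function over the hyperplane orthogonal to some unit vector
   [e]; [g] is only used on that hyperplane. *)
Definition lipschitz_boundary Omega : Prop :=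
  forall x, boundary Omega x ->
  exists (e : 'rV[R]_d) (g : 'rV[R]_d -> R) (L : R),
    [/\ enorm e = 1,
        forall y z, `|g y - g z| <= L * enorm (y - z) &
        \forall y \near x,
          Omega y <-> g (y - dot y e *: e) < dot y e].

Definition polyhedral_boundary Omega : Prop :=
  exists (n : nat) (F : 'I_n -> 'I_d -> 'rV[R]_d),
    (forall k, affinely_independent (F k) [set: 'I_d]%SET) /\
    boundary Omega = \bigcup_k hull (F k) [set: 'I_d]%SET.

Definition polyhedral_lipschitz_domain Omega : Prop :=
  [/\ open Omega, connected Omega, Omega !=set0 & bounded_set Omega] /\
  lipschitz_boundary Omega /\ polyhedral_boundary Omega.

End geometry.

(** * Function spaces on [Omega]

   Functions are defined on all of [R^d]; only their values in [Omega], up to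
   a null set, matter. *)

Section spaces.
Context {R : realType} {d : nat} (Omega : set 'rV[R]_d).
Local Notation E := ('rV[R]_d).
Local Notation mu := (@lebesgue_rV R d).
Implicit Types (phi f g q r : E -> R) (v : E -> E).

Definition partial (i : 'I_d) f : E -> R := 'D_(delta_mx ord0 i) f.

Fixpoint Ck (k : nat) f : Prop :=
  match k with
  | 0%N => continuous f
  | k'.+1 => continuous f /\ forall i : 'I_d,
      (forall x, derivable f x (delta_mx ord0 i)) /\ Ck k' (partial i f)
  end.

Definition test_function phi : Prop :=
  (forall k, Ck k phi) /\
  exists K : set E, [/\ compact K, K `<=` Omega &
                        forall x, ~ K x -> phi x = 0].

Definition L2 f : Prop := (f \_ Omega) \in Lfun mu 2%:E.

Definition L2v v : Prop := forall i, L2 (fun x => v x ord0 i).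

Definition L20 q : Prop := L2 q /\ \int[mu]_(x in Omega) q x = 0.

Definition weak_partial_of (i : 'I_d) f g : Prop :=
  L2 g /\ forall phi, test_function phi ->
  \int[mu]_(x in Omega) (f x * partial i phi x) =
  - \int[mu]_(x in Omega) (g x * phi x).

Definition weak_div_of v g : Prop :=
  L2 g /\ forall phi, test_function phi ->
  \int[mu]_(x in Omega) (\sum_(i < d) v x ord0 i * partial i phi x) =
  - \int[mu]_(x in Omega) (g x * phi x).

(* Weak derivatives are unique up to null sets; [wpartial] and [wdiv] pick a
   representative, and are 0 when there is no square-integrable weak
   derivative. *)
Definition wpartial (i : 'I_d) f : E -> R := xget (cst 0) (weak_partial_of i f).

Definition wdiv v : E -> R := xget (cst 0) (weak_div_of v).

Definition wgrad f : E -> E := fun x => \row_i wpartial i f x.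

Definition H1 f : Prop :=
  L2 f /\ forall i, exists g, weak_partial_of i f g.

Definition H1norm f : R :=
  Num.sqrt (\int[mu]_(x in Omega) f x ^+ 2 +
            \sum_(i < d) \int[mu]_(x in Omega) wpartial i f x ^+ 2).

Definition H10 f : Prop :=
  H1 f /\ exists phi : nat -> E -> R, (forall n, test_function (phi n)) /\
    H1norm (f \- phi n) @[n --> \oo] --> 0.

Definition V v : Prop := forall i, H10 (fun x => v x ord0 i).

Definition Hdiv v : Prop := L2v v /\ exists g, weak_div_of v g.

(* The normal trace [v.n] of [v] in H(div) is the element of H^{-1/2}, the
   dual of the trace space of H^1(Omega), defined by this duality pairing with
   the trace of [phi] in H^1(Omega). *)
Definition normal_trace v phi : R :=
  \int[mu]_(x in Omega) dot (v x) (wgrad phi x) +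
  \int[mu]_(x in Omega) (wdiv v x * phi x).

Definition H0div v : Prop :=
  Hdiv v /\ forall phi, H1 phi -> normal_trace v phi = 0.

End spaces.

(** * Triangulations and finite element spaces *)

Record mesh (R : realType) (d : nat) := Mesh {
  nnode : nat;
  node : 'I_nnode -> 'rV[R]_d;
  (* the elements, as sets of vertices *)
  cells : {set {set 'I_nnode}} }.

Section mesh.
Context {R : realType} {d : nat} (Omega : set 'rV[R]_d) (M : mesh R d).
Local Notation E := ('rV[R]_d).
Local Notation mu := (@lebesgue_rV R d).
Local Notation vset := {set 'I_(nnode M)}.
Implicit Types (T e : vset).

Definition triangulation : Prop :=
  [/\ injective (@node _ _ M),
      forall T, T \in cells M ->
        #|T| = d.+1 /\ affinely_independent (@node _ _ M) T,
      closure Omega =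
        \bigcup_(T in [set T | T \in cells M]) hull (@node _ _ M) T &
      forall T T', T \in cells M -> T' \in cells M ->
        hull (@node _ _ M) T `&` hull (@node _ _ M) T' =
        hull (@node _ _ M) (T :&: T')%SET].

Definition shape_regular (sigma : R) : Prop :=
  forall T, T \in cells M ->
    diameter (hull (@node _ _ M) T) <=
    sigma * indiameter (hull (@node _ _ M) T).

(* Elements are taken open; this does not affect a.e. statements and
   integrals, as faces are null sets. *)
Definition elem T : set E := (hull (@node _ _ M) T)°.

Definition elem_diam T : R := diameter (elem T).

Definition faces : {set vset} :=
  [set e : vset | (#|e| == d) && [exists T in cells M, e \subset T]]%SET.

Definition interior_faces : {set vset} :=
  [set e in faces | #|[set T in cells M | e \subset T]| == 2%N]%SET.

Definition unit_normal e (n : E) : Prop :=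
  enorm n = 1 /\
  forall i j, i \in e -> j \in e -> dot n (node i - node j) = 0.

Definition Vh1 (v : E -> E) : Prop :=
  V Omega v /\ forall T, T \in cells M -> exists (A : 'M[R]_d) (b : E),
    v = (fun x => x *m A + b) %[ae mu in elem T].

Definition RT0 (v : E -> E) : Prop :=
  H0div Omega v /\ forall T, T \in cells M -> exists (a : E) (b : R),
    v = (fun x => a + b *: x) %[ae mu in elem T].

Definition Wh (q : E -> R) : Prop :=
  L20 Omega q /\ forall T, T \in cells M -> exists c : R,
    q = cst c %[ae mu in elem T].

Definition RT0_basis_function e (Phi : E -> E) : Prop :=
  [/\ RT0 Phi,
      forall T, T \in cells M -> ~~ (e \subset T) ->
        Phi = cst 0 %[ae mu in elem T] &
      forall T, T \in cells M -> e \subset T -> exists (a : E) (b : R),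
        Phi = (fun x => a + b *: x) %[ae mu in elem T] /\
        forall e' n x, e' \in faces -> e' \subset T -> unit_normal e' n ->
          hull (@node _ _ M) e' x ->
          (e' = e -> dot (a + b *: x) n <> 0) /\
          (e' <> e -> dot (a + b *: x) n = 0)].

Definition Vh (v : E -> E) : Prop :=
  exists v1 vR, [/\ Vh1 v1, RT0 vR & v = v1 \+ vR].

(* The decomposition in [Vh1 (+) RT0], unique up to null sets. *)
Definition Vh_split (v : E -> E) : (E -> E) * (E -> E) :=
  xget (cst 0, cst 0) [set w | [/\ Vh1 w.1, RT0 w.2 &
    v = w.1 \+ w.2 %[ae mu in Omega]]].

Definition part1 v := (Vh_split v).1.
Definition partR v := (Vh_split v).2.

(** * The discrete Stokes problem *)

Definition form_a (u v : E -> E) : R :=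
  \sum_(i < d) \int[mu]_(x in Omega)
    dot (wgrad Omega (fun y => u y ord0 i) x)
        (wgrad Omega (fun y => v y ord0 i) x).

Definition form_b (v : E -> E) (q : E -> R) : R :=
  \int[mu]_(x in Omega) (wdiv Omega v x * q x).

Section forms.
Variables (alpha : vset -> R) (Phi : vset -> E -> E).

(* The coefficients [v_e] of an element of RT0 in the basis [Phi]. *)
Definition RT0_coef (v : E -> E) : vset -> R :=
  xget (cst 0) [set c : vset -> R |
    v = (fun x => \sum_(e in interior_faces) c e *: Phi e x)
      %[ae mu in Omega]].

Definition form_a0 (u v : E -> E) : R :=
  \sum_(T in cells M) alpha T * elem_diam T ^- 2 *
    \int[mu]_(x in elem T) dot (u x) (v x).

Definition form_aD (u v : E -> E) : R :=
  \sum_(T in cells M) \sum_(e in interior_faces | e \subset T)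
    alpha T * elem_diam T ^- 2 * RT0_coef u e * RT0_coef v e *
    \int[mu]_(x in elem T) dot (Phi e x) (Phi e x).

Definition form_adiv (u v : E -> E) : R :=
  \sum_(T in cells M) \sum_(e in interior_faces | e \subset T)
    alpha T * RT0_coef u e * RT0_coef v e *
    \int[mu]_(x in elem T) (wdiv Omega (Phi e) x * wdiv Omega (Phi e) x).

Variant stabilization := Stab0 | StabD | StabDiv.

Definition form_aR (s : stabilization) : (E -> E) -> (E -> E) -> R :=
  match s with
  | Stab0 => form_a0
  | StabD => form_aD
  | StabDiv => form_adiv
  end.

Definition form_ah (s : stabilization) (u v : E -> E) : R :=
  form_a (part1 u) (part1 v) + form_aR s (partR u) (partR v).

Definition stokes_solution (s : stabilization) (nu : R) (f u : E -> E)
    (p : E -> R) : Prop :=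
  [/\ Vh u, Wh p,
      forall v, Vh v -> nu * form_ah s u v - form_b v p =
                        \int[mu]_(x in Omega) dot (f x) (v x) &
      forall q, Wh q -> form_b u q = 0].

Definition stokes_unique_solution (s : stabilization) (nu : R) (f u : E -> E)
    (p : E -> R) : Prop :=
  stokes_solution s nu f u p /\
  forall u' p', stokes_solution s nu f u' p' ->
    u' = u %[ae mu in Omega] /\ p' = p %[ae mu in Omega].

End forms.

Definition L2_projection (r Pr : E -> R) : Prop :=
  Wh Pr /\ forall q, Wh q -> \int[mu]_(x in Omega) ((r x - Pr x) * q x) = 0.

End mesh.

(* Main.v *)
(* For [v] in [Vh], Green's formula gives (grad psi, v) = - (psi, div v): on the
   conforming part by density of test functions in [H10], on the RT0 part by
   the definition of the vanishing normal trace.  As [v] is affine on every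
   element, [div v] is elementwise constant, so [psi] can be replaced by its
   projection: (grad psi, v) = - b(v, Ppsi).  Adding grad psi to the data is
   thus compensated by adding [Ppsi] to the pressure, and conversely, which
   also transports uniqueness.

   That [div v] is elementwise constant requires weak derivatives to be unique
   almost everywhere: a function orthogonal to all test functions has zero
   integral over small boxes, because products of [exp (-1 / (m t))] are test
   functions converging to indicators of boxes, and boxes generate the
   sigma-algebra. *)
From HB Require Import structures.
From mathcomp Require Import all_boot all_order all_algebra.
From mathcomp Require Import all_classical all_reals all_analysis.
From mathcomp Require Import measurable_realfun.
From mathcomp Require Import ring lra.
Require Import Defs.

Set Implicit Arguments.
Unset Strict Implicit.
Unset Printing Implicit Defensive.

Import Order.TTheory GRing.Theory Num.Theory.
Import numFieldNormedType.Exports.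

Local Open Scope classical_set_scope.
Local Open Scope ring_scope.

(** The measure on rows is an iterated product, with the sigma-algebra generated by the coordinates.
    Measurability of open sets therefore comes from countable covers by boxes, and integration by
    parts for test functions from an induction on the dimension with Fubini. [wpartial] and [wdiv]
    are representatives picked by [xget], so nothing can be computed about them directly: an
    identity is proved for an explicit weak derivative and carried over almost everywhere by
    uniqueness. Two obstacles remain in the projection step. An element is the interior of a simplex
    known only to lie in the closure of [Omega]; the Lipschitz boundary places it inside [Omega],
    where the test functions live. And [Wh] has zero mean, so the mean of the divergence is
    subtracted before it tests the projection. Since the velocity is kept, the term [form_ah] is the
    same in the original and in the shifted equation. *)

(** * Boxes and measurability of open sets *)

Section boxes.
Context {R : realType} {n : nat}.
Implicit Types (a b x : 'rV[R]_n) (U : set 'rV[R]_n).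

Definition obox a b : set 'rV[R]_n :=
  [set x | forall i, a ord0 i < x ord0 i < b ord0 i].

Definition cbox a b : set 'rV[R]_n :=
  [set x | forall i, a ord0 i <= x ord0 i <= b ord0 i].

Lemma obox_sub_cbox a b : obox a b `<=` cbox a b.
Proof. by move=> x xab i; have /andP[/ltW -> /ltW ->] := xab i. Qed.

Lemma measurable_forall_coord (Y : 'I_n -> set R) :
  (forall i, measurable (Y i)) ->
  measurable [set x : 'rV[R]_n | forall i, Y i (x ord0 i)].
Proof.
move=> mY.
rewrite (_ : [set x | _] = \bigcap_(i in [set: 'I_n])
    ((fun x : 'rV[R]_n => x ord0 i) @^-1` Y i)); last first.
  by apply/seteqP; split=> x /= xY i; [move=> _; exact: xY|exact: xY].
apply: fin_bigcap_measurable => // i _.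
by rewrite -[X in measurable X]setTI; exact: measurable_coord.
Qed.

Lemma measurable_obox a b : measurable (obox a b).
Proof.
rewrite (_ : obox a b =
    [set x | forall i, `]a ord0 i, b ord0 i[%classic (x ord0 i)]).
  exact: (@measurable_forall_coord (fun i => `]a ord0 i, b ord0 i[%classic)).
by apply/seteqP; split=> x xab i; have := xab i; rewrite /= in_itv.
Qed.

Lemma cbox_compact a b : compact (cbox a b).
Proof.
rewrite (_ : cbox a b =
    [set x | forall i, `[a ord0 i, b ord0 i]%classic (x ord0 i)]).
  by apply: (@rV_compact R n (fun i => `[a ord0 i, b ord0 i]%classic)) => i;
    exact: segment_compact.
by apply/seteqP; split=> x xab i; have := xab i; rewrite /= in_itv.
Qed.

Lemma nbhs_cbox x U : nbhs x U ->
  exists2 e : R, 0 < e & cbox (x - const_mx e) (x + const_mx e) `<=` U.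
Proof.
move=> /nbhs_ballP[e /= e0 xeU]; exists (e / 2); first by rewrite divr_gt0.
move=> y yx; apply: xeU; split=> // i j; rewrite ord1.
have := yx j; rewrite !mxE /ball /= ltr_norml => /andP[? ?].
by apply/andP; split; lra.
Qed.

Lemma rat_near (x e : R) : 0 < e -> exists q : rat, `|x - ratr q| < e.
Proof.
move=> e0; have [q] := @rat_in_itvoo R (x - e) (x + e) ltac:(lra).
by rewrite in_itv/= => /andP[? ?]; exists q; rewrite ltr_norml; lra.
Qed.

(** Boxes with rational centre and radius $1/(m+1)$ are countably many. The closed boxes are kept
    inside [U] because they later serve as compact supports; the open ones already cover [U]. *)
Lemma open_bigcup_box U : open U -> exists (P : set nat) (a b : nat -> 'rV[R]_n),
  (forall k, P k -> cbox (a k) (b k) `<=` U) /\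
  U = \bigcup_(k in P) obox (a k) (b k).
Proof.
move=> oU; pose I := ('rV[rat]_n * nat)%type.
pose c (i : I) : 'rV[R]_n := map_mx ratr i.1.
pose r (i : I) : 'rV[R]_n := const_mx (i.2.+1%:R^-1).
(* A number that encodes no pair gets a default box, which counts only if the index set below finds
   it inside [U]. *)
pose g k : I := odflt (0, 0%N) (unpickle k).
exists [set k | cbox (c (g k) - r (g k)) (c (g k) + r (g k)) `<=` U].
exists (fun k => c (g k) - r (g k)), (fun k => c (g k) + r (g k)).
split=> //; apply/seteqP; split=> [x Ux|x [k /= kU /obox_sub_cbox xk]]; last exact: kU.
have [e e0 xeU] := nbhs_cbox (open_nbhs_nbhs (conj oU Ux)).
(* Half of [e], since a point of the box is within $1/(m+1)$ of the centre and the centre within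
   $1/(m+1)$ of [x]. *)
have [m me] : exists m : nat, m.+1%:R^-1 < e / 2.
  have e20 : 0 < e / 2 by rewrite divr_gt0.
  exists (Num.trunc (e / 2)^-1); rewrite invf_plt ?posrE//.
  by rewrite truncnS_gt.
have m0 : 0 < m.+1%:R^-1 :> R by rewrite invr_gt0.
have {}/choice[q xq] i := rat_near (x ord0 i) m0.
exists (pickle (\row_i q i : 'rV[rat]_n, m)); rewrite /g /= pickleK /=.
  move=> y yq; apply: xeU => i; move: (yq i) (xq i) me m0.
  rewrite !mxE; move: (m.+1%:R^-1) => t.
  by rewrite ltr_norml => /andP[? ?] /andP[? ?] ? ?; apply/andP; split; lra.
move=> i; move: (xq i) me m0.
rewrite !mxE; move: (m.+1%:R^-1) => t.
by rewrite ltr_norml => /andP[? ?] ? ?; apply/andP; split; lra.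
Qed.

Lemma open_measurable_rV U : open U -> measurable U.
Proof.
move=> /open_bigcup_box[P [a [b [_ ->]]]].
by apply: bigcup_measurable => k _; exact: measurable_obox.
Qed.

Lemma closed_measurable_rV U : closed U -> measurable U.
Proof.
move=> cU; rewrite -(setCK U); apply: measurableC; apply: open_measurable_rV.
exact: closed_openC.
Qed.

Lemma continuous_measurable_rV (f : 'rV[R]_n -> R) (D : set 'rV[R]_n) :
  measurable D -> continuous f -> measurable_fun D f.
Proof.
move=> mD /continuousP cf; apply: (measurable_funS measurableT) => //.
apply: (measurability _ (measurable_realfun.RGenOpens.measurableE R)) => //.
move=> _ [_ [a [b ->] <-]]; rewrite setTI; apply: open_measurable_rV; apply: cf.
exact: interval_open.
Qed.

End boxes.

(** * Finite Lebesgue measure of bounded sets *)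

Section finite_measure.
Context {R : realType}.
Local Notation mu := (@lebesgue_rV R _).

Lemma lebesgue_rVSE n (A : set 'rV[R]_n.+1) :
  lebesgue_rV n.+1 A =
  (@lebesgue_measure R \x lebesgue_rV n)%E (@cons_row R n @^-1` A).
Proof. by []. Qed.

Lemma closed_cbox n (a b : 'rV[R]_n) : closed (cbox a b).
Proof. by apply: compact_closed; [exact: norm_hausdorff|exact: cbox_compact]. Qed.

Lemma measurable_cbox n (a b : 'rV[R]_n) : measurable (cbox a b).
Proof.
by apply: closed_measurable_rV; exact: closed_cbox.
Qed.

Lemma lebesgue_rV_cbox_lty n (a b : 'rV[R]_n) : (lebesgue_rV n (cbox a b) < +oo)%E.
Proof.
elim: n a b => [|n IHn] a b; first by rewrite /= diracE ltry.
rewrite lebesgue_rVSE (_ : _ @^-1` _ = `[a ord0 ord0, b ord0 ord0]%classic `*`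
    cbox (behead_row a).2 (behead_row b).2).
  rewrite product_measure1E//; last exact: measurable_cbox.
  apply: lte_mul_pinfty => //.
  have := @lebesgue_measure_itv R `[a ord0 ord0, b ord0 ord0] => /= ->; case: ifP => // _; rewrite -EFinB.
apply/seteqP; split=> [[t x] /= xab|[t x] [/= tab xab] i].
  split=> [|i]; first by have := xab ord0; rewrite mxE unlift_none in_itv.
  by have := xab (lift ord0 i); rewrite !mxE liftK.
rewrite mxE; case: unliftP => [j ->|->]; last by move: tab; rewrite in_itv.
by have := xab j; rewrite !mxE.
Qed.

Lemma normr_coord_le n (x : 'rV[R]_n) i : `|x ord0 i| <= `|x|.
Proof.
rewrite [leRHS]/Num.norm/= mx_normrE.
exact: (le_bigmax _ (fun ij => `|x ij.1 ij.2|) (ord0, i)).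
Qed.

Lemma bounded_sub_cbox n (A : set 'rV[R]_n) : bounded_set A ->
  exists2 N : R, 0 < N & A `<=` cbox (- const_mx N) (const_mx N).
Proof.
move=> [N0 [_ N0A]]; exists (`|N0| + 1) => [|x Ax i]; first by rewrite ltr_wpDl.
have N1 : N0 < `|N0| + 1 by rewrite (le_lt_trans (ler_norm _))// ltrDl.
by have := le_trans (normr_coord_le x i) (N0A _ N1 _ Ax); rewrite ler_norml !mxE.
Qed.

Lemma bounded_lebesgue_rV_lty n (A : set 'rV[R]_n) :
  measurable A -> bounded_set A -> (lebesgue_rV n A < +oo)%E.
Proof.
move=> mA /bounded_sub_cbox[N _ AN].
apply: le_lt_trans (lebesgue_rV_cbox_lty (- const_mx N) (const_mx N)).
by apply: le_measure => //; rewrite inE//; exact: measurable_cbox.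
Qed.

End finite_measure.

(** * Continuous functions with compact support *)

Section compact_support.
Context {R : realType} {n : nat}.
Local Notation mu := (@lebesgue_rV R n).

Lemma continuous_row (T : topologicalType) (f : T -> 'rV[R]_n) :
  (forall i, continuous (fun t => f t ord0 i)) -> continuous f.
Proof.
move=> cf t A [P nP PA]; rewrite nbhs_filterE.
have : forall i j, \forall s \near t, P i j (f s i j).
  by move=> i j; rewrite ord1; exact: (cf j t _ (nP ord0 j)).
move=> h; apply: (@filterS _ (nbhs t) _ _ (f @^-1` A)); last first.
  exact: (filter_forall _ (fun i => filter_forall _ (h i))).
by move=> s hs; exact: PA.
Qed.

Lemma compact_support_integrable (f : 'rV[R]_n -> R) (K : set 'rV[R]_n) :
  compact K -> continuous f -> (forall x, ~ K x -> f x = 0) ->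
  mu.-integrable setT (EFin \o f).
Proof.
move=> cK cf f0.
have mK : measurable K.
  by apply: closed_measurable_rV; apply: compact_closed => //; exact: norm_hausdorff.
have muK : (mu K < +oo)%E.
  by apply: bounded_lebesgue_rV_lty => //; exact: compact_bounded.
have fK : (EFin \o f) = (EFin \o f) \_ K.
  apply/funext => x; rewrite patchE; case: ifPn => //.
  by move/negP; rewrite inE /= => /f0 ->.
rewrite fK; apply: (integrable_mkcond _ mK).1.
apply: measurable_bounded_integrable => //.
  exact: continuous_measurable_rV.
have /compact_bounded : compact (f @` K).
  by apply: continuous_compact => //; exact: continuous_subspaceT.
move=> [M [Mr fM]]; exists M; split=> // r rM x Kx.
by apply: (fM r rM); exists x.
Qed.

Lemma partial_support (i : 'I_n) (f : 'rV[R]_n -> R) (K : set 'rV[R]_n) :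
  closed K -> (forall x, ~ K x -> f x = 0) ->
  forall x, ~ K x -> partial i f x = 0.
Proof.
move=> cK f0 x Kx; rewrite /partial.
have -> : 'D_(delta_mx ord0 i) f x = 'D_(delta_mx ord0 i) (cst 0 : _ -> R) x.
  apply: near_eq_derive.
  have : nbhs x (~` K) by apply: open_nbhs_nbhs; split => //; exact: closed_openC.
  by apply: filterS => y /f0 ->.
exact: derive_cst.
Qed.

End compact_support.

(** * Fubini along the first coordinate and integrals of partial derivatives *)

Section integral_cons.
Context {R : realType} (n : nat).
Local Open Scope ereal_scope.
Local Notation prodmu := (@lebesgue_measure R \x lebesgue_rV n).

Lemma integrable_cons (f : 'rV[R]_n.+1 -> \bar R) :
  (lebesgue_rV n.+1).-integrable setT f ->
  prodmu.-integrable setT (f \o @cons_row R n).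
Proof.
move=> fi0; have mabs := measurable_int _ (integrable_abse fi0).
have /integrableP[mf fi] := fi0; apply/integrableP; split.
  have mc := @measurable_cons_row R n.
  exact: (measurable_comp measurableT (@subsetT _ _) mf mc).
move: fi; rewrite [X in X < _](@ge0_integral_pushforward _ _ _ _ R (@cons_row R n)
  (@measurable_cons_row R n) prodmu setT (abse \o f))//.
by move=> y _; exact: abse_ge0.
Qed.

Lemma integral_cons (f : 'rV[R]_n.+1 -> \bar R) :
  (lebesgue_rV n.+1).-integrable setT f ->
  \int[lebesgue_rV n.+1]_x f x = \int[prodmu]_p f (cons_row p).
Proof.
move=> fi; rewrite [LHS](@integral_pushforward _ _ _ _ R (@cons_row R n)
  (@measurable_cons_row R n) prodmu setT f)//; first exact: measurable_int fi.
exact: integrable_cons.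
Qed.

End integral_cons.

Section integral_partial.
Context {R : realType}.
Local Notation prodmu n := (@lebesgue_measure R \x lebesgue_rV n)%E.

Lemma cons_row_shift0 n (h t : R) (y : 'rV[R]_n) :
  cons_row (h + t, y) = h *: delta_mx ord0 ord0 + cons_row (t, y).
Proof.
apply/rowP => k; rewrite !mxE; case: unliftP => [j ->|->]; rewrite eqxx.
  by rewrite andTb [_ == _]eq_sym (negbTE (neq_lift _ _)) mulr0 add0r.
by rewrite eqxx mulr1.
Qed.

Lemma cons_row_shiftS n (h t : R) (y : 'rV[R]_n) j :
  cons_row (t, h *: delta_mx ord0 j + y) =
  h *: delta_mx ord0 (lift ord0 j) + cons_row (t, y).
Proof.
apply/rowP => k; rewrite !mxE; case: unliftP => [j' ->|->]; rewrite ?mxE eqxx.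
  by rewrite (inj_eq (@lift_inj _ _)).
by rewrite (negbTE (neq_lift _ _)) mulr0 add0r.
Qed.

Lemma continuous_cons_row n (t : R) : continuous (fun y : 'rV[R]_n => cons_row (t, y)).
Proof.
apply: continuous_row => k; case: (unliftP ord0 k) => [j ->|->].
  rewrite (_ : (fun y => _) = fun y : 'rV_n => y ord0 j); first exact: coord_continuous.
  by apply/funext => y; rewrite mxE liftK.
rewrite (_ : (fun y => _) = cst t); first exact: cst_continuous.
by apply/funext => y; rewrite mxE unlift_none.
Qed.

Lemma continuous_cons_row0 n (y : 'rV[R]_n) : continuous (fun t : R => cons_row (t, y)).
Proof.
apply: continuous_row => k; case: (unliftP ord0 k) => [j ->|->].
  rewrite (_ : (fun t => _) = cst (y ord0 j)); first exact: cst_continuous.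
  by apply/funext => t; rewrite mxE liftK.
rewrite (_ : (fun t => _) = id); first by move=> t A.
by apply/funext => t; rewrite mxE unlift_none.
Qed.

(** The two difference quotients are the same function of [h]. This moves a directional derivative
    between spaces, for instance from a row to its tail or to the real line. *)
Lemma derive_eq_along (V V' : normedModType R) (f : V -> R) (f' : V' -> R)
    (a v : V) (a' v' : V') :
  (forall h : R, f (h *: v + a) = f' (h *: v' + a')) ->
  (derivable f a v -> derivable f' a' v') /\ 'D_v f a = 'D_v' f' a'.
Proof.
move=> ff'; have ff0 : f a = f' a' by have := ff' 0; rewrite !scale0r !add0r.
rewrite /derivable /derive.
rewrite (_ : (fun h => _ *: ((f \o _) _ - _)) =
             (fun h => h^-1 *: ((f' \o shift a') (h *: v') - f' a')))//.
by apply/funext => h /=; rewrite ff' ff0.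
Qed.

(** Fubini is used in the order that makes the inner integral vanish: over the tail, by induction,
    for a tail direction; along the first axis, by the fundamental theorem of calculus, for the
    first direction. The support is put in a cube because its slices are again cubes with the same
    [N]. *)
Lemma integral_partial_box n (i : 'I_n) (g : 'rV[R]_n -> R) (N : R) : 0 < N ->
  (forall x, derivable g x (delta_mx ord0 i)) ->
  continuous (partial i g) ->
  (forall x, ~ cbox (- const_mx N) (const_mx N) x -> g x = 0) ->
  (\int[lebesgue_rV n]_x (partial i g x)%:E = 0)%E.
Proof.
move=> N0; elim: n i g => [|n IHn] i g; first by case: i.
move=> dg cg g0.
have pg0 := partial_support i (@closed_cbox R _ _ _) g0.
have ig := compact_support_integrable (@cbox_compact _ _ _ _) cg pg0.
rewrite integral_cons//; have iG := integrable_cons ig.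
case: (unliftP ord0 i) => [j ij|i0].
  rewrite -[LHS](integral12_prod_meas1 iG) /fubini_F.
  apply: integral0_eq => t _ /=.
  have H y := @derive_eq_along _ _ g (fun y => g (cons_row (t, y))) (cons_row (t, y))
    (delta_mx ord0 i) y (delta_mx ord0 j).
  have {}H y := H y (fun h => congr1 g (etrans (congr1 (fun i => _ *: delta_mx _ i + _) ij)
    (esym (cons_row_shiftS h t y j)))).
  have E y : partial i g (cons_row (t, y)) = partial j (fun y => g (cons_row (t, y))) y.
    exact: (H y).2.
  under eq_integral do rewrite E.
  apply: IHn => [y||y].
  - exact: (H y).1.
  - rewrite (_ : partial _ _ = partial i g \o (fun y => cons_row (t, y))).
      by move=> y; apply: continuous_comp; [exact: continuous_cons_row|exact: cg].
    by apply/funext => y /=; rewrite E.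
  - move=> yN; apply: g0 => xN; apply: yN => k.
    by have := xN (lift ord0 k); rewrite !mxE liftK.
rewrite -[LHS](integral21_prod_meas1 iG) /fubini_G.
apply: integral0_eq => y _ /=.
pose F t := g (cons_row (t, y)).
have H t := @derive_eq_along _ _ g F (cons_row (t, y)) (delta_mx ord0 i) t 1.
have {}H t : (derivable g (cons_row (t, y)) (delta_mx ord0 i) -> derivable F t 1) /\
    partial i g (cons_row (t, y)) = 'D_1 F t.
  by apply: H => h; rewrite /F [h *: 1]mulr1 cons_row_shift0 i0.
have E t : partial i g (cons_row (t, y)) = 'D_1 F t by exact: (H t).2.
have dF t : derivable F t 1 by exact: (H t).1.
have F0 t : N < `|t| -> F t = 0.
  move=> Nt; apply: g0 => /(_ ord0); rewrite !mxE unlift_none /= -ler_norml.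
  by rewrite leNgt Nt.
have cF : continuous F.
  by move=> t; apply: differentiable_continuous; exact/derivable1_diffP.
(* The margin 1 makes [F0], which needs $N < |t|$ strictly, applicable at both end points. *)
have D0 t : t \notin `[- (N + 1), N + 1] -> 'D_1 F t = 0.
  move=> tN; rewrite -E; apply: pg0 => /(_ ord0); rewrite !mxE unlift_none /=.
  by move: tN; rewrite in_itv/= => /negP tN tN'; apply: tN; apply/andP; split; lra.
under eq_integral do rewrite E.
rewrite (_ : (fun t => _) = (fun t => ('D_1 F t)%:E) \_ `[- (N + 1), N + 1]); last first.
  apply/funext => t; rewrite patchE mem_setE; case: ifPn => // /D0 ->//.
rewrite -integral_mkcond (@continuous_FTC2 _ _ F).
- by rewrite !F0 ?subee// ?normrN ger0_norm; lra.
- lra.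
- apply: continuous_subspaceT.
  rewrite (_ : (fun t => _) = partial i g \o (fun t => cons_row (t, y))).
    by move=> t; apply: continuous_comp; [exact: continuous_cons_row0|exact: cg].
  by apply/funext => t /=; rewrite E.
- split; first by move=> t _; exact: dF.
    apply: cvg_at_right_filter; exact: cF.
  apply: cvg_at_left_filter; exact: cF.
- by move=> t _; rewrite derive1E.
Qed.

Lemma integral_partial n (i : 'I_n) (g : 'rV[R]_n -> R) (K : set 'rV[R]_n) :
  compact K ->
  (forall x, derivable g x (delta_mx ord0 i)) ->
  continuous (partial i g) ->
  (forall x, ~ K x -> g x = 0) ->
  (\int[lebesgue_rV n]_x (partial i g x)%:E = 0)%E.
Proof.
move=> /compact_bounded/bounded_sub_cbox[N N0 KN] dg cg g0.
by apply: (integral_partial_box N0) => // x xN; apply: g0 => /KN.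
Qed.

End integral_partial.

(** * Flat functions $P(1/y) e^{-1/y}$ extended by 0 *)

Section flat.
Context {R : realType}.
Implicit Types (P : {poly R}) (x y : R).

(** The polynomial factor in $1/y$ makes the family stable under differentiation, so one
    differentiability result covers all orders. *)
Definition flat P y : R := if 0 < y then P.[y^-1] * expR (- y^-1) else 0.

(** The exponential series gives $s^k / k! \le e^s$, so $k!$ is a bound. *)
Lemma exprn_expRN_bound k : exists C : R, forall s, 0 <= s -> s ^+ k * expR (- s) <= C.
Proof.
exists (k`!%:R) => s s0; rewrite expRN ler_pdivrMr ?expR_gt0//.
case: k => [|k]; first by rewrite fact0 mul1r expr0 -expR0 ler_expR.
rewrite -ler_pdivrMl ?ltr0n ?fact_gt0// mulrC.
by apply: le_trans (expR_ge1Dxn k s0); rewrite lerDr.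
Qed.

Lemma poly_expRN_bound P :
  exists C : R, forall s, 0 <= s -> `|P.[s] * expR (- s)| <= C.
Proof.
have /choice[C hC] := exprn_expRN_bound.
exists (\sum_(i < size P) `|P`_i| * C i) => s s0.
rewrite horner_coef mulr_suml (le_trans (ler_norm_sum _ _ _))// ler_sum// => i _.
rewrite -mulrA normrM ler_wpM2l// ger0_norm ?hC// mulr_ge0 ?expR_ge0//.
exact: exprn_ge0.
Qed.

(** With $s = 1/y$ one has $d/dy = -s^2 \, d/ds$ and $(P e^{-s})' = (P' - P) e^{-s}$. *)
Definition flat_derive P : {poly R} := 'X^2 * (P - P^`()).

Lemma is_derive_flat_pos P y : 0 < y ->
  is_derive y 1 (flat P) (flat (flat_derive P) y).
Proof.
move=> y0; pose g t : R := P.[t^-1] * expR (- t^-1).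
apply: (@near_eq_is_derive _ _ _ g).
  by near=> t; rewrite /flat /g ifT//; near: t; exact: lt_nbhsr.
have yn0 : y != 0 by rewrite gt_eqF.
have dV : is_derive y 1 (fun t : R => t^-1) (- y ^- 2).
  by have := @is_deriveV _ id y 1 1 yn0 (is_derive_id _ _); rewrite [_ *: 1]mulr1.
have dP : is_derive y 1 (fun t => P.[t^-1]) (P^`().[y^-1] * - y ^- 2).
  exact: (@is_derive1_comp _ (horner P) (fun t => t^-1) y _ _ (is_derive_poly P y^-1) dV).
have dE : is_derive y 1 (fun t => expR (- t^-1)) (expR (- y^-1) * y ^- 2).
  apply: (@is_derive1_comp _ expR (fun t => - t^-1) y _ _ (is_derive_expR _)).
  by have := is_deriveN dV; rewrite opprK.
have := is_deriveM dP dE.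
congr (is_derive _ _ _ _).
rewrite /flat y0 /flat_derive !hornerE /= /GRing.scale /=.
by rewrite -exprVn; ring.
Unshelve. all: by end_near. Qed.

Lemma is_derive_flat P y : is_derive y 1 (flat P) (flat (flat_derive P) y).
Proof.
have [y0|y0|<-] := ltgtP 0 y; first exact: is_derive_flat_pos.
  rewrite {2}/flat ltNge (ltW y0)/=.
  apply: (@near_eq_is_derive _ _ _ (cst 0)).
  near=> t; rewrite /flat ifF//; apply/negbTE; rewrite -leNgt ltW//.
  by near: t; exact: lt_nbhsl.
(* At 0 the right difference quotient is $h^{-1} P(1/h) e^{-1/h} = h \cdot (X^2 P)(1/h) e^{-1/h}$,
   hence at most $C h$ in absolute value. Passing to $C + 1$ below gives a positive divisor. *)
have [C hC] := poly_expRN_bound ('X^2 * P).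
have C1 : 0 < C + 1.
  by have := le_trans (normr_ge0 _) (hC 0 (lexx 0)); lra.
rewrite {2}/flat ltxx.
have cv : h^-1 *: ((flat P \o shift 0) (h *: 1) - flat P 0) @[h --> 0^'] --> (0 : R).
  apply/cvgrPdist_le => e e0; near=> h.
  have hn0 : h != 0 by near: h; exact: nbhs_dnbhs_neq.
  rewrite sub0r normrN /= [h *: 1]mulr1 addr0 {2}/flat ltxx subr0 /flat.
  case: ifPn => h0; last by rewrite scaler0 normr0 ltW.
  have := hC h^-1; rewrite invr_ge0 ltW// => /(_ isT) {}hC.
  rewrite (_ : _ *: _ = h * (('X^2 * P).[h^-1] * expR (- h^-1))); last first.
    by rewrite !hornerE /= /GRing.scale /=; field.
  have C0 : 0 <= C by exact: le_trans hC.
  rewrite normrM (ger0_norm (ltW h0)) (@le_trans _ _ (h * (C + 1)))//.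
    by apply: ler_wpM2l; [exact: ltW|rewrite (le_trans hC)// lerDl].
  rewrite -ler_pdivlMr// (le_trans (ler_norm _))//.
  by near: h; apply: dnbhs0_le; exact: divr_gt0.
by apply: DeriveDef; [exact: cvgP cv|exact: cvg_lim].
Unshelve. all: by end_near. Qed.

Lemma flat1_ge0 y : 0 <= flat 1 y.
Proof. by rewrite /flat; case: ifP => // _; rewrite hornerC mul1r expR_ge0. Qed.

Lemma flat1_le1 y : flat 1 y <= 1.
Proof.
rewrite /flat; case: ifP => // y0; rewrite hornerC mul1r -expR0 ler_expR.
by rewrite oppr_le0 invr_ge0 ltW.
Qed.

Lemma cvg_flat1 y : flat 1 (m.+1%:R * y) @[m --> \oo] --> ((0 < y)%R%:R : R).
Proof.
have [y0|y0] := boolP (0 < y); last first.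
  rewrite (_ : (fun m => _) = cst 0); first exact: cvg_cst.
  by apply/funext => m; rewrite /flat pmulr_rgt0// (negbTE y0).
rewrite (_ : (fun m => _) = (fun m => expR (- (y^-1 * m.+1%:R^-1)))); last first.
  by apply/funext => m; rewrite /flat pmulr_rgt0// y0 hornerC mul1r invfM mulrC.
rewrite -[1%:R]expR0 -oppr0 -[in X in _ --> X](mulr0 y^-1).
apply: continuous_cvg; first exact: continuous_expR.
apply: cvgN; apply: cvgMr; exact: cvg_harmonic.
Qed.

End flat.

(** * Smooth functions and bumps on boxes *)

Section smooth.
Context {R : realType} {n : nat}.
Local Notation E := 'rV[R]_n.

(* Closed under partial derivatives, hence contained in [Ck k] for all [k]. *)
Inductive smooth_fun : (E -> R) -> Prop :=
| smooth_cst c : smooth_fun (fun=> c)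
| smooth_flat P i a c : smooth_fun (fun x => flat P (c * x ord0 i + a))
| smooth_add f g : smooth_fun f -> smooth_fun g -> smooth_fun (fun x => f x + g x)
| smooth_mul f g : smooth_fun f -> smooth_fun g -> smooth_fun (fun x => f x * g x).

Lemma smooth_fun_differentiable f : smooth_fun f -> forall x, differentiable f x.
Proof.
elim=> {f} [c|P i a c|f g _ df _ dg|f g _ df _ dg] x.
- exact: differentiable_cst.
- apply: (@differentiable_comp _ _ _ _ (fun x : E => c * x ord0 i + a) (flat P)).
    apply: differentiableD; last exact: differentiable_cst.
    by apply: differentiableM; [exact: differentiable_cst|exact: differentiable_coord].
  apply/derivable1_diffP; apply: ex_derive; exact: is_derive_flat.
- exact: differentiableD.
- exact: differentiableM.
Qed.

Lemma smooth_fun_partial f : smooth_fun f -> forall i, smooth_fun (partial i f).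
Proof.
elim=> {f} [c|P i a c|f g sf pf sg pg|f g sf pf sg pg] j.
- rewrite (_ : partial _ _ = fun=> 0); first exact: smooth_cst.
  by apply/funext => x; exact: derive_cst.
- pose dj : R := c * (j == i)%:R.
  rewrite (_ : partial _ _ = fun x => dj * flat (flat_derive P) (c * x ord0 i + a)).
    by apply: smooth_mul; [exact: smooth_cst|exact: smooth_flat].
  apply/funext => x; rewrite /partial.
  (* In the direction $e_j$ the argument of [flat P] moves with speed [dj]; linearity of the
     differential then extracts the factor [dj]. *)
  have H h : flat P (c * (h *: delta_mx ord0 j + x) ord0 i + a) =
      flat P (h *: dj + (c * x ord0 i + a)).
    by rewrite !mxE eqxx andTb /dj eq_sym [h *: _]mulrCA addrA -mulrDr.
  rewrite (derive_eq_along (f := fun x : E => flat P (c * x ord0 i + a)) H).2.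
  have d1 : derivable (flat P) (c * x ord0 i + a) 1.
    by apply: ex_derive; exact: is_derive_flat.
  rewrite deriveE; last exact/derivable1_diffP.
  rewrite -[X in 'd _ _ X]mulr1 [dj * 1](_ : _ = dj *: (1 : R))// linearZ /=.
  rewrite -deriveE; last exact/derivable1_diffP.
  by congr (_ * _); apply: derive_val; exact: is_derive_flat.
- rewrite (_ : partial _ _ = fun x => partial j f x + partial j g x).
    exact: smooth_add.
  apply/funext => x; apply: deriveD; apply: diff_derivable;
    exact: smooth_fun_differentiable.
- rewrite (_ : partial _ _ = fun x => f x * partial j g x + g x * partial j f x).
    by apply: smooth_add; apply: smooth_mul.
  apply/funext => x; apply: deriveM; apply: diff_derivable;
    exact: smooth_fun_differentiable.
Qed.

Lemma smooth_fun_Ck f : smooth_fun f -> forall k, Ck k f.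
Proof.
move=> sf k; elim: k f sf => [|k IHk] f sf /=.
  by move=> x; apply: differentiable_continuous; exact: smooth_fun_differentiable.
split.
  by move=> x; apply: differentiable_continuous; exact: smooth_fun_differentiable.
move=> i; split; last by apply: IHk; exact: smooth_fun_partial.
by move=> x; apply: diff_derivable; exact: smooth_fun_differentiable.
Qed.

Lemma smooth_fun_prod (I : Type) (r : seq I) (f : I -> E -> R) :
  (forall i, smooth_fun (f i)) -> smooth_fun (fun x => \prod_(i <- r) f i x).
Proof.
move=> sf; elim: r => [|i r IHr].
  by under eq_fun do rewrite big_nil; exact: smooth_cst.
by under eq_fun do rewrite big_cons; exact: smooth_mul.
Qed.

(* [exp (-1/(m t))] increases to the indicator function of [t > 0]. *)
Definition bump (a b : E) (m : nat) (x : E) : R :=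
  \prod_(i < n) (flat 1 (m.+1%:R * (x ord0 i - a ord0 i)) *
                 flat 1 (m.+1%:R * (b ord0 i - x ord0 i))).

Lemma bump_test_function (U : set E) a b m :
  cbox a b `<=` U -> test_function U (bump a b m).
Proof.
move=> abU; split.
  apply: smooth_fun_Ck; apply: smooth_fun_prod => i; apply: smooth_mul.
    under eq_fun do rewrite mulrDr; exact: smooth_flat.
  by under eq_fun do rewrite mulrDr mulrN -mulNr addrC; exact: smooth_flat.
exists (cbox a b); split=> //; first exact: cbox_compact.
move=> x /existsNP[i xi]; rewrite /bump (bigD1 i)//= /flat !pmulr_rgt0// !subr_gt0.
case: ifPn => ai; last by rewrite !mul0r.
case: ifPn => bi; last by rewrite mulr0 mul0r.
by exfalso; apply: xi; rewrite !ltW.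
Qed.

Lemma bump_norm_le1 a b m x : `|bump a b m x| <= 1.
Proof.
rewrite normr_prod; apply: prodr_ile1 => i _.
by rewrite normr_ge0 ger0_norm ?mulr_ge0 ?flat1_ge0// mulr_ile1 ?flat1_ge0 ?flat1_le1.
Qed.

(** Each factor tends to 1 where its argument is positive and is 0 elsewhere, including on the
    faces; hence the limit is the open box. *)
Lemma cvg_bump a b x : bump a b m x @[m --> \oo] --> (\1_(obox a b) x : R).
Proof.
have -> : \1_(obox a b) x =
    \prod_(i < n) ((0 < x ord0 i - a ord0 i)%R%:R * (0 < b ord0 i - x ord0 i)%R%:R) :> R.
  rewrite indicE; have [|] := boolP (x \in obox a b).
    rewrite inE => xab; rewrite big1// => i _.
    by have /andP[ax xb] := xab i; rewrite !subr_gt0 ax xb mulr1.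
  rewrite notin_setE => /existsNP[i]; rewrite (bigD1 i)//= !subr_gt0.
  by case: (_ < _) => /=; [case: (_ < _) => //= _; rewrite mulr0 mul0r|rewrite !mul0r].
rewrite /bump; elim: (index_enum _) => [|i r IHr].
  rewrite big_nil; under eq_fun do rewrite big_nil; exact: cvg_cst.
rewrite big_cons; under eq_fun do rewrite big_cons.
by apply: cvgM; [apply: cvgM; exact: cvg_flat1|exact: IHr].
Qed.

End smooth.

(** * Fundamental lemma of the calculus of variations *)

Section fundamental_lemma.
Context {R : realType} {n : nat}.
Local Notation E := 'rV[R]_n.
Local Notation mu := (@lebesgue_rV R n).

(** The pi-system for the Dynkin argument. A factor may be the whole line, so that the preimage of
    an interval under one coordinate belongs to the family. *)
Definition open_rectangles : set (set E) :=
  [set A | exists Y : 'I_n -> set R,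
    (forall i, Y i = setT \/ exists s t, Y i = `]s, t[%classic) /\
    A = [set x : E | forall i, Y i (x ord0 i)]].

Lemma setI_closed_open_rectangles : setI_closed open_rectangles.
Proof.
move=> _ _ [Y [hY ->]] [Z [hZ ->]]; exists (fun i => Y i `&` Z i); split.
  move=> i; have [->|[s [t ->]]] := hY i; first by rewrite setTI.
  have [->|[s' [t' ->]]] := hZ i; first by rewrite setIT; right; exists s, t.
  right; exists (Num.max s s'), (Num.min t t'); apply/seteqP; split=> r /=;
    rewrite !in_itv/= gt_max lt_min.
    by move=> [/andP[-> ->] /andP[-> ->]].
  by move=> /andP[/andP[-> ->] /andP[-> ->]].
apply/seteqP; split=> x /= => [[Yx Zx] i|YZx]; first by split.
by split=> i; have [] := YZx i.
Qed.

(** It suffices that every coordinate be measurable for the generated sigma-algebra, which is tested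
    on open intervals. *)
Lemma measurable_open_rectangles (A : set E) :
  measurable A -> <<s open_rectangles>> A.
Proof.
move=> mA; suff : g_sigma_preimage (fun i (x : E) => x ord0 i) `<=` <<s open_rectangles>>.
  exact.
apply: smallest_sub; first exact: smallest_sigma_algebra.
rewrite -bigcup_seq => B [i _] [Y mY <-].
have mi : measurable_fun (T := g_sigma_algebraType open_rectangles) setT
    (fun x : E => x ord0 i).
  apply: (measurability _ (measurable_realfun.RGenOpens.measurableE R)) => //.
  move=> _ [_ [s [t ->] <-]]; apply: sub_sigma_algebra.
  exists (fun j => if j == i then `]s, t[%classic else setT); split.
    by move=> j; case: ifP => _; [right; exists s, t|left].
  rewrite setTI; apply/seteqP; split=> x /= => [xi j|/(_ i)]; last by rewrite eqxx.
  by case: eqP => [->|].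
exact: mi.
Qed.

Section integrand.
Variables (U : set E) (h : E -> R).
Hypotheses (oU : open U) (ih : mu.-integrable U (EFin \o h)).
Hypothesis h0 : forall phi, test_function U phi -> \int[mu]_(x in U) (h x * phi x) = 0.

Let mU : measurable U. Proof. exact: open_measurable_rV. Qed.

(** Dominated convergence along the bumps: they are bounded by 1, so the absolute value of [h]
    dominates. *)
Lemma integral_obox0 a b : cbox a b `<=` U -> (\int[mu]_(x in obox a b) (h x)%:E = 0)%E.
Proof.
move=> abU; have mh := measurable_int _ ih.
have mb m : measurable_fun U (bump a b m).
  apply: continuous_measurable_rV => //.
  exact: ((bump_test_function m abU).1 0%N).
have ihb m : mu.-integrable U (EFin \o (fun x => h x * bump a b m x)).
  have := @integrableMl _ _ _ mu U mU (EFin \o h) (bump a b m) ih (mb m).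
  apply; exists 1; split=> // r r1 x _ /=.
  by rewrite (le_trans (bump_norm_le1 a b m x))// ltW.
have I0 m : (\int[mu]_(x in U) (h x * bump a b m x)%:E = 0)%E.
  (* [h0] concerns the real-valued integral, which is also 0 when the extended one is infinite;
     integrability excludes that case. *)
  rewrite -[LHS]fineK; last exact: integrable_fin_num (ihb m).
  by have := h0 (bump_test_function m abU); rewrite /Rintegral => ->.
have cvg_h x : (h x * bump a b m x)%:E @[m --> \oo] --> (h x * \1_(obox a b) x)%:E.
  apply: cvg_EFin; first exact: nearW.
  by apply: cvgMr; exact: cvg_bump.
have mh1 : measurable_fun U (EFin \o (fun x : E => h x * \1_(obox a b) x)).
  rewrite (_ : _ \o _ = (EFin \o h) \_ (obox a b)).
    apply/measurable_restrict => //; first exact: measurable_obox.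
    exact: measurable_funS mh.
  by rewrite epatch_indic.
have [_ _ c] : [/\ mu.-integrable U (fun x => (h x * \1_(obox a b) x)%:E),
    (\int[mu]_(x in U) `|(h x * bump a b m x)%:E - (h x * \1_(obox a b) x)%:E|)%E
      @[m --> \oo] --> 0%E &
    (\int[mu]_(x in U) (h x * bump a b m x)%:E)%E @[m --> \oo] -->
      (\int[mu]_(x in U) (h x * \1_(obox a b) x)%:E)%E].
  apply: (@dominated_convergence _ _ _ mu U mU
    (fun m x => (h x * bump a b m x)%:E) _ (abse \o (EFin \o h))) => //.
  - by move=> m; exact: measurable_int (ihb m).
  - by apply: aeW => x _; exact: cvg_h.
  - exact: integrable_abse.
  - by apply: aeW => x m _; rewrite /= lee_fin normrM ler_piMr// bump_norm_le1.
have : (\int[mu]_(x in U) (h x * \1_(obox a b) x)%:E = 0)%E.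
  apply: cvg_unique c _ => //.
  by rewrite (_ : (fun m => _) = cst 0%E); [exact: cvg_cst|exact/funext].
move=> I1; have UE : U `&` obox a b = obox a b.
  by apply/setIidPr => x /obox_sub_cbox; exact: abU.
by rewrite -{1}UE integral_mkcondr epatch_indic.
Qed.

(** Inside a fixed box, the sets over which [h] integrates to 0 form a Dynkin system. It contains
    the open rectangles because a rectangle cut with the box is again an open box. *)
Lemma integral_sub_obox0 a b A : cbox a b `<=` U -> measurable A ->
  (\int[mu]_(x in obox a b `&` A) (h x)%:E = 0)%E.
Proof.
move=> abU /measurable_open_rectangles.
have mab : measurable (obox a b) by exact: measurable_obox.
have abU' : obox a b `<=` U by move=> x /obox_sub_cbox; exact: abU.
pose H : set (set E) := [set A | measurable A /\
  (\int[mu]_(x in obox a b `&` A) (h x)%:E = 0)%E].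
suff : <<s open_rectangles>> `<=` H by move=> /[apply] -[].
have iS B : measurable B -> mu.-integrable (obox a b `&` B) (EFin \o h).
  move=> mB; apply: integrableS ih => //; first exact: measurableI.
  by move=> x [] /abU'.
rewrite -(setI_closed_g_dynkin_g_sigma_algebra setI_closed_open_rectangles).
apply: smallest_sub.
  split.
  - by split=> //; rewrite setIT; exact: integral_obox0.
  - move=> B [mB B0]; split; first exact: measurableC.
    have BU : obox a b = obox a b `&` B `|` obox a b `&` ~` B.
      by rewrite -setIUr setUv setIT.
    have := integral_obox0 abU; rewrite {1}BU integral_setU//.
    + by rewrite B0 add0e.
    + exact: measurableI.
    + by apply: measurableI => //; exact: measurableC.
    + rewrite -setIUr setUv; exact: measurable_int (iS _ measurableT).
    + by apply/disj_setPS => x [[_ Bx] [_]].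
  - move=> F tF HF; have mF k : measurable (F k) by have [] := HF k.
    split; first exact: bigcupT_measurable.
    rewrite setI_bigcupr integral_bigcup//.
    + by rewrite eseries0// => k _ _; have [_ ->] := HF k.
    + exact: trivIset_setIl.
    + by move=> k; exact: measurableI.
    + by rewrite -setI_bigcupr; apply: iS; exact: bigcupT_measurable.
move=> _ [Y [hY ->]]; split.
  apply: measurable_forall_coord => i.
  by have [->|[s [t ->]]] := hY i.
(* The end points of the cut box in each coordinate; the two bounds keep its closed version inside
   [U]. *)
have /choice[s hs] i : exists st : R * R, [/\ a ord0 i <= st.1, st.2 <= b ord0 i &
    forall r, st.1 < r < st.2 <-> a ord0 i < r < b ord0 i /\ Y i r].
  have [->|[s [t ->]]] := hY i.
    by exists (a ord0 i, b ord0 i); split => // r; split=> [|[]].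
  exists (Num.max (a ord0 i) s, Num.min (b ord0 i) t) => /=; split.
  - by rewrite le_max lexx.
  - by rewrite ge_min lexx.
  - move=> r; rewrite in_itv/= gt_max lt_min; split.
      by move=> /andP[/andP[-> ->] /andP[-> ->]].
    by move=> [/andP[-> ->] /andP[-> ->]].
rewrite (_ : _ `&` _ = obox (\row_i (s i).1) (\row_i (s i).2)).
  apply: integral_obox0 => x xs; apply: abU => i.
  have := xs i; rewrite !mxE => /andP[sx xs'].
  by have [sa sb _] := hs i; rewrite (le_trans sa sx) (le_trans xs' sb).
apply/seteqP; split=> x /=.
  by move=> [xab Yx] i; rewrite !mxE; have [_ _ ->] := hs i; split; [exact: xab|].
move=> xs; split=> i; have [_ _ /(_ (x ord0 i))[+ _]] := hs i.
  by move=> /(_ _)[|//]; have := xs i; rewrite !mxE.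
by move=> /(_ _)[|//]; have := xs i; rewrite !mxE.
Qed.

(** On each box of a countable cover, vanishing integrals over all measurable subsets force [h] to
    be 0 almost everywhere; the exceptional null sets are countably many. *)
Lemma ae_eq0_test_function : h = cst 0 %[ae mu in U].
Proof.
have [P [a [b [PU UE]]]] := open_bigcup_box oU.
have aek k : \forall x \ae mu, P k -> obox (a k) (b k) x -> h x = 0.
  have [Pk|nPk] := pselect (P k); last by apply: aeW.
  have mk := @measurable_obox _ _ (a k) (b k).
  have ik : mu.-integrable (obox (a k) (b k)) (EFin \o h).
    by apply: integrableS ih => // x /obox_sub_cbox; exact: PU.
  have hk : ae_eq mu (obox (a k) (b k)) (EFin \o h) (cst 0%E).
    apply: integral_ae_eq => // B Bk mB.
    by rewrite integral0 -(setIidr Bk); apply: integral_sub_obox0 => //; exact: PU.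
  by apply: filterS hk => x hx _ /hx[].
apply: filterS (ae_foralln aek) => x hx.
by rewrite UE => -[k Pk kx]; exact: hx kx.
Qed.

End integrand.
End fundamental_lemma.

(** * Square-integrable functions and the Cauchy-Schwarz inequality *)

Section square_integrable.
Context {R : realType} {d : nat} (Omega : set 'rV[R]_d).
Hypothesis mO : measurable Omega.
Local Notation E := 'rV[R]_d.
Local Notation mu := (@lebesgue_rV R d).
Implicit Types f g : E -> R.

Lemma L2D f g : L2 Omega f -> L2 Omega g -> L2 Omega (fun x => f x + g x).
Proof.
rewrite /L2 => hf hg.
rewrite (_ : _ \_ _ = (f \_ Omega) + (g \_ Omega)).
  by apply: (Lfun_addr_closed mu _).2; rewrite ?lee_fin ?ler1n.
by apply/funext => x; rewrite !fctE !patchE; case: ifP; rewrite ?addr0.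
Qed.

Lemma L2Z (k : R) f : L2 Omega f -> L2 Omega (fun x => k * f x).
Proof.
rewrite /L2 => hf; rewrite (_ : _ \_ _ = k \o* (f \_ Omega)).
  by apply: Lfun_scale => //; rewrite ler1n.
by apply/funext => x /=; rewrite !patchE; case: ifP => _; [rewrite mulrC|rewrite mul0r].
Qed.

Lemma L2N f : L2 Omega f -> L2 Omega (fun x => - f x).
Proof.
by move=> /(L2Z (-1)); congr (L2 _ _); apply/funext => x; rewrite mulN1r.
Qed.

Lemma L2B f g : L2 Omega f -> L2 Omega g -> L2 Omega (fun x => f x - g x).
Proof. by move=> hf /L2N; exact: L2D. Qed.

Lemma L2_0 : L2 Omega (fun=> 0).
Proof.
rewrite /L2 (_ : _ \_ _ = 0); last by apply/funext => x; rewrite patchE if_same.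
by apply: (Lfun_addr_closed mu _).1; rewrite lee_fin ler1n.
Qed.

Lemma L2_sum (I : Type) (r : seq I) (F : I -> E -> R) :
  (forall i, L2 Omega (F i)) -> L2 Omega (fun x => \sum_(i <- r) F i x).
Proof.
move=> hF; elim: r => [|i r IHr].
  rewrite (_ : (fun x => _) = fun=> 0); first exact: L2_0.
  by apply/funext => x; rewrite big_nil.
rewrite (_ : (fun x => _) = fun x => F i x + \sum_(j <- r) F j x); first exact: L2D.
by apply/funext => x; rewrite big_cons.
Qed.

Lemma L2M_integrable f g : L2 Omega f -> L2 Omega g ->
  mu.-integrable Omega (EFin \o (fun x => f x * g x)).
Proof.
move=> hf hg; apply/integrable_mkcond => //.
have /Lfun1_integrable := Lfun2_mul_Lfun1 hf hg.
congr (_.-integrable _ _); apply/funext => x /=; rewrite !patchE.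
by case: ifP => _ //=; rewrite mulr0.
Qed.

Lemma integrable_L2 f : measurable_fun Omega f ->
  mu.-integrable Omega (EFin \o (fun x => f x ^+ 2)) -> L2 Omega f.
Proof.
move=> mf fi; rewrite /L2 inE; apply/andP; split; rewrite inE /=.
  exact: (measurable_restrictT _ mO).1.
rewrite /finite_norm unlock /= poweR_lty//.
have /(integrable_mkcond _ mO).1/integrableP[_] := fi.
congr (_ < _)%E; apply: eq_integral => x _ /=.
rewrite !patchE; case: ifP => _ /=; last by rewrite normr0 powR0.
by rewrite powR_mulrn// normrX.
Qed.

Lemma L2_cst (c : R) : bounded_set Omega -> L2 Omega (fun=> c).
Proof.
move=> bO; apply: integrable_L2; first exact: measurable_cst.
apply: measurable_bounded_integrable => //.
- exact: bounded_lebesgue_rV_lty.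
- by exists (`|c ^+ 2|); split=> // r cr x _ /=; exact: ltW.
Qed.

Lemma L2_integrable f : bounded_set Omega -> L2 Omega f ->
  mu.-integrable Omega (EFin \o f).
Proof.
move=> bO hf; have := L2M_integrable hf (L2_cst 1 bO).
by congr (_.-integrable _ _); apply/funext => x /=; rewrite mulr1.
Qed.

Lemma L2_compact_support f (K : set E) : compact K -> continuous f ->
  (forall x, ~ K x -> f x = 0) -> L2 Omega f.
Proof.
move=> cK cf f0; apply: integrable_L2; first exact: continuous_measurable_rV.
apply: (@integrableS _ _ _ mu setT) => //.
apply: (compact_support_integrable cK).
  by move=> x; apply: (@continuousM _ _ f f); exact: cf.
by move=> x /f0 ->; rewrite expr2 mul0r.
Qed.

Lemma Rintegral_sqrD f g (t : R) : L2 Omega f -> L2 Omega g ->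
  \int[mu]_(x in Omega) (f x + t * g x) ^+ 2 =
  \int[mu]_(x in Omega) f x ^+ 2 + t * (\int[mu]_(x in Omega) (f x * g x) *+ 2) +
  t ^+ 2 * \int[mu]_(x in Omega) g x ^+ 2.
Proof.
move=> hf hg.
have iff := L2M_integrable hf hf; have ifg := L2M_integrable hf hg.
have igg := L2M_integrable hg hg.
have i1 := integrableZl mO (2 * t) ifg; have i2 := integrableZl mO (t ^+ 2) igg.
have i01 := integrableD mO iff i1.
transitivity (\int[mu]_(x in Omega) (f x * f x + 2 * t * (f x * g x) + t ^+ 2 * (g x * g x))).
  by apply: eq_Rintegral => x _; ring.
rewrite (RintegralD mO i01 i2) (RintegralD mO iff i1).
rewrite (RintegralZl (2 * t) mO ifg) (RintegralZl (t ^+ 2) mO igg).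
by congr (_ + _ + _); ring.
Qed.

(** The quadratic polynomial $t \mapsto \int (f + t g)^2$ is nonnegative. *)
Lemma cauchy_schwarz f g : L2 Omega f -> L2 Omega g ->
  (\int[mu]_(x in Omega) (f x * g x)) ^+ 2 <=
  \int[mu]_(x in Omega) f x ^+ 2 * \int[mu]_(x in Omega) g x ^+ 2.
Proof.
move=> hf hg; have q t := Rintegral_sqrD t hf hg.
have {q} : forall t, 0 <= \int[mu]_(x in Omega) f x ^+ 2 +
    t * (\int[mu]_(x in Omega) (f x * g x) *+ 2) + t ^+ 2 * \int[mu]_(x in Omega) g x ^+ 2.
  by move=> t; rewrite -q; apply: Rintegral_ge0 => x _; exact: sqr_ge0.
have : 0 <= \int[mu]_(x in Omega) g x ^+ 2.
  by apply: Rintegral_ge0 => x _; exact: sqr_ge0.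
move: (\int[mu]_(x in Omega) f x ^+ 2) (\int[mu]_(x in Omega) (f x * g x))
  (\int[mu]_(x in Omega) g x ^+ 2) => A B C.
rewrite le_eqVlt => /predU1P[<-|C0] q.
  have [->|B0] := eqVneq B 0; first by rewrite expr0n mulr0.
  (* For $C = 0$ the polynomial is affine; this [t] would give it the value $-1$. *)
  have := q (- (A + 1) / (B *+ 2)); rewrite mulr0 addr0 -mulrA mulVf ?mulr1.
    by move=> ?; exfalso; lra.
  by rewrite mulrn_eq0.
(* The minimizer of the polynomial. *)
have := q (- B / C); rewrite (_ : _ + _ = A - B ^+ 2 / C); last first.
  by field; rewrite gt_eqF.
by rewrite subr_ge0 ler_pdivrMr.
Qed.

End square_integrable.

(** * Test functions and classical integration by parts *)

Section test_functions.
Context {R : realType} {d : nat} (Omega : set 'rV[R]_d).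
Local Notation E := 'rV[R]_d.
Local Notation mu := (@lebesgue_rV R d).

Lemma test_functionS (U : set E) (phi : E -> R) : U `<=` Omega ->
  test_function U phi -> test_function Omega phi.
Proof.
by move=> UO [ck [K [cK KU phi0]]]; split=> //; exists K; split=> //; exact: subset_trans UO.
Qed.

Lemma test_function_partial i (phi : E -> R) :
  test_function Omega phi -> test_function Omega (partial i phi).
Proof.
move=> [ck [K [cK KO phi0]]]; split; first by move=> k; exact: ((ck k.+1).2 i).2.
exists K; split=> //; apply: partial_support => //.
by apply: compact_closed => //; exact: norm_hausdorff.
Qed.

Lemma L2_test_function (phi : E -> R) : measurable Omega ->
  test_function Omega phi -> L2 Omega phi.
Proof.
by move=> mO [ck [K [cK KO phi0]]]; apply: (L2_compact_support mO cK) => //; exact: (ck 0%N).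
Qed.

Lemma Rintegral_supported (U : set E) (f : E -> R) : U `<=` Omega ->
  (forall x, ~ U x -> f x = 0) ->
  \int[mu]_(x in Omega) f x = \int[mu]_(x in U) f x.
Proof.
move=> UO f0; rewrite Rintegral_mkcond [RHS]Rintegral_mkcond; congr Rintegral.
apply/funext => x; rewrite !patchE.
have [Ux|nUx] := pselect (U x); first by rewrite !mem_set//; exact: UO.
by rewrite f0// !if_same.
Qed.

(** The product [f phi] has compact support in [Omega], so its partial derivative integrates to 0
    over the whole space. [f] itself may have any support; it will be an affine coordinate or
    another test function. *)
Lemma integration_by_parts_test i (f phi : E -> R) : measurable Omega ->
  continuous f -> (forall x, derivable f x (delta_mx ord0 i)) ->
  continuous (partial i f) -> test_function Omega phi ->
  \int[mu]_(x in Omega) (f x * partial i phi x) =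
  - \int[mu]_(x in Omega) (partial i f x * phi x).
Proof.
move=> mO cf df cdf tphi; have [ckd _] := test_function_partial i tphi.
have [ck [K [cK KO phi0]]] := tphi; have dphi := ((ck 1%N).2 i).1.
have cphi : continuous phi := ck 0%N; have cdphi : continuous (partial i phi) := ckd 0%N.
have dphi0 : forall x, ~ K x -> partial i phi x = 0.
  by apply: partial_support => //; apply: compact_closed => //; exact: norm_hausdorff.
have pE x : partial i (fun y => f y * phi y) x = f x * partial i phi x + partial i f x * phi x.
  by rewrite [partial i f x * _]mulrC; apply: deriveM.
have c1 : continuous (fun x => f x * partial i phi x).
  by move=> x; apply: continuousM; [exact: cf|exact: cdphi].
have c2 : continuous (fun x => partial i f x * phi x).
  by move=> x; apply: continuousM; [exact: cdf|exact: cphi].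
have s1 x : ~ K x -> f x * partial i phi x = 0 by move=> /dphi0 ->; rewrite mulr0.
have s2 x : ~ K x -> partial i f x * phi x = 0 by move=> /phi0 ->; rewrite mulr0.
have i1 := compact_support_integrable cK c1 s1.
have i2 := compact_support_integrable cK c2 s2.
have sT (g : E -> R) : (forall x, ~ K x -> g x = 0) ->
    \int[mu]_(x in Omega) g x = \int[mu]_x g x.
  move=> g0; rewrite (Rintegral_supported KO g0) Rintegral_mkcond; congr Rintegral.
  apply/funext => x; rewrite !patchE; case: ifPn => //; rewrite notin_setE => /g0.
  by move=> ->.
apply/eqP; rewrite (sT _ s1) (sT _ s2) -addr_eq0 -RintegralD//; apply/eqP.
have I0 : (\int[mu]_x (f x * partial i phi x + partial i f x * phi x)%:E = 0)%E.
  under eq_integral do rewrite -pE.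
  apply: (integral_partial cK).
  - by move=> x; apply: derivableM.
  - rewrite (_ : partial _ _ = fun x => f x * partial i phi x + partial i f x * phi x).
      by move=> x; exact: (cvgD (c1 x) (c2 x)).
    exact/funext.
  - by move=> x /phi0 ->; rewrite mulr0.
by rewrite /Rintegral I0.
Qed.

Lemma continuous_bigsum (I : Type) (r : seq I) (F : I -> E -> R) :
  (forall i, continuous (F i)) -> continuous (fun x => \sum_(i <- r) F i x).
Proof.
move=> cF; elim: r => [|i r IHr].
  rewrite (_ : (fun x => _) = cst 0); first exact: cst_continuous.
  by apply/funext => x; rewrite big_nil.
rewrite (_ : (fun x => _) = fun x => F i x + \sum_(j <- r) F j x).
  by move=> x; exact: (cvgD (cF i x) (IHr x)).
by apply/funext => x; rewrite big_cons.
Qed.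

Lemma continuous_dotl (c : E) : continuous (fun x : E => dot x c).
Proof.
apply: (@continuous_bigsum _ _ (fun j x => x ord0 j * c ord0 j)) => j x.
exact: (cvgM (@coord_continuous R 1 d ord0 j x) (cvg_cst _)).
Qed.

Lemma continuous_affine_coord (A : 'M[R]_d) (b : E) i :
  continuous (fun x : E => (x *m A + b) ord0 i).
Proof.
rewrite (_ : (fun x => _) = fun x : E => dot x (col i A)^T + b ord0 i).
  by move=> x; exact: (cvgD (@continuous_dotl _ x) (cvg_cst _)).
by apply/funext => x; rewrite !mxE; congr (_ + _); apply: eq_bigr => j _; rewrite !mxE.
Qed.

Lemma integration_by_parts_affine (A : 'M[R]_d) (b : E) i (phi : E -> R) :
  measurable Omega -> test_function Omega phi ->
  \int[mu]_(x in Omega) ((x *m A + b) ord0 i * partial i phi x) =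
  - \int[mu]_(x in Omega) (A i i * phi x).
Proof.
move=> mO tphi; pose f x := (x *m A + b) ord0 i.
have fE h x : f (h *: delta_mx ord0 i + x) = h *: A i i + f x.
  rewrite /f mulmxDl -addrA !mxE; congr (_ + _).
  rewrite (bigD1 i)//= big1 ?addr0; first by rewrite !mxE !eqxx mulr1.
  by move=> j /negPf ji; rewrite !mxE ji andbF mulr0 mul0r.
have H x := @derive_eq_along R _ _ id f (f x) (A i i) x (delta_mx ord0 i)
  (fun h => esym (fE h x)).
have pf : partial i f = fun=> A i i.
  by apply/funext => x; rewrite /partial -(H x).2 derive_id.
rewrite (@integration_by_parts_test i f)// ?pf//.
- exact: continuous_affine_coord.
- by move=> x; apply: (H x).1; exact: derivable_id.
- exact: cst_continuous.
Qed.

End test_functions.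

(** * Weak derivatives and divergences *)

Section weak_derivatives.
Context {R : realType} {d : nat} (Omega : set 'rV[R]_d).
Hypotheses (oO : open Omega) (bO : bounded_set Omega).
Local Notation E := 'rV[R]_d.
Local Notation mu := (@lebesgue_rV R d).
Implicit Types (f g psi : E -> R) (v : E -> E).

Let mO : measurable Omega. Proof. exact: open_measurable_rV. Qed.

Lemma Rintegral_sum (D : set E) (I : Type) (r : seq I) (F : I -> E -> R) :
  measurable D -> (forall i, mu.-integrable D (EFin \o F i)) ->
  \int[mu]_(x in D) (\sum_(i <- r) F i x) = \sum_(i <- r) \int[mu]_(x in D) F i x.
Proof.
move=> mD iF; pose G r x := \sum_(i <- r) F i x.
have iG s : mu.-integrable D (EFin \o G s).
  elim: s => [|i s IHs].
    rewrite (_ : _ \o _ = cst 0%E); first exact: integrable0.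
    by apply/funext => x; rewrite /G /= big_nil.
  rewrite (_ : _ \o _ = fun x => ((F i x)%:E + (G s x)%:E)%E).
    exact: (integrableD mD (iF i) IHs).
  by apply/funext => x; rewrite /G /= big_cons.
elim: r => [|i r IHr].
  rewrite big_nil (@eq_Rintegral _ _ _ mu D (cst 0)).
    by rewrite Rintegral_cst// mul0r.
  by move=> x _; rewrite big_nil.
rewrite big_cons -IHr -(RintegralD mD (iF i) (iG r)).
by apply: eq_Rintegral => x _; rewrite big_cons.
Qed.

Lemma ae_eq_Rintegral (D : set E) f g : measurable D ->
  mu.-integrable D (EFin \o f) -> mu.-integrable D (EFin \o g) ->
  f = g %[ae mu in D] -> \int[mu]_(x in D) f x = \int[mu]_(x in D) g x.
Proof.
move=> mD fi gi fg; congr fine; apply: ae_eq_integral => //.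
- exact: measurable_int fi.
- exact: measurable_int gi.
- by apply: filterS fg => x fg Dx /=; rewrite fg.
Qed.

Lemma L2_test_integrable f phi : L2 Omega f -> test_function Omega phi ->
  mu.-integrable Omega (EFin \o (fun x => f x * phi x)).
Proof. by move=> hf tphi; apply: L2M_integrable => //; exact: L2_test_function. Qed.

Lemma ae_eq_test_function f g : L2 Omega f -> L2 Omega g ->
  (forall phi, test_function Omega phi ->
    \int[mu]_(x in Omega) (f x * phi x) = \int[mu]_(x in Omega) (g x * phi x)) ->
  f = g %[ae mu in Omega].
Proof.
move=> hf hg fg.
have : (fun x => f x - g x) = cst 0 %[ae mu in Omega].
  apply: ae_eq0_test_function => // [|phi tphi].
    by apply: L2_integrable => //; exact: L2B.
  have if1 := L2_test_integrable hf tphi; have ig1 := L2_test_integrable hg tphi.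
  under eq_Rintegral do rewrite mulrBl.
  by rewrite RintegralB// fg// subrr.
by apply: filterS => x fgx Ox; apply/eqP; rewrite -subr_eq0; apply/eqP; exact: fgx.
Qed.

Lemma weak_partial_unique i f g g' :
  weak_partial_of Omega i f g -> weak_partial_of Omega i f g' ->
  g = g' %[ae mu in Omega].
Proof.
move=> [hg fg] [hg' fg']; apply: ae_eq_test_function => // phi tphi.
by apply: oppr_inj; rewrite -fg// -fg'.
Qed.

Lemma weak_div_unique v g g' :
  weak_div_of Omega v g -> weak_div_of Omega v g' -> g = g' %[ae mu in Omega].
Proof.
move=> [hg vg] [hg' vg']; apply: ae_eq_test_function => // phi tphi.
by apply: oppr_inj; rewrite -vg// -vg'.
Qed.

Lemma H1_wpartial f i : H1 Omega f -> weak_partial_of Omega i f (wpartial Omega i f).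
Proof. by move=> [_ /(_ i)]; exact: xgetPex. Qed.

(** Allows an explicit weak divergence to replace the representative chosen by [xget]. *)
Lemma wdiv_ae_eq v g : weak_div_of Omega v g -> wdiv Omega v = g %[ae mu in Omega].
Proof.
move=> vg; apply: weak_div_unique (vg).
by apply: (xgetPex (cst 0)); exists g.
Qed.

Lemma L2_wdiv v : (exists g, weak_div_of Omega v g) -> L2 Omega (wdiv Omega v).
Proof. by move=> /(xgetPex (cst 0))[]. Qed.

(** Needed to read [H1norm] of [f \- phi], whose derivatives are chosen anew for the difference and
    not as differences. *)
Lemma weak_partialB_test f g i phi : L2 Omega f -> weak_partial_of Omega i f g ->
  test_function Omega phi ->
  weak_partial_of Omega i (f \- phi) (fun x => g x - partial i phi x).
Proof.
move=> hf [hg fg] tphi; have tdphi := test_function_partial i tphi.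
have hphi := L2_test_function mO tphi; have hdphi := L2_test_function mO tdphi.
split; first exact: L2B.
move=> chi tchi; have tdchi := test_function_partial i tchi.
have i1 := L2_test_integrable hf tdchi; have i2 := L2_test_integrable hphi tdchi.
have i3 := L2_test_integrable hg tchi; have i4 := L2_test_integrable hdphi tchi.
under eq_Rintegral do rewrite /= mulrBl.
under [in RHS]eq_Rintegral do rewrite mulrBl.
rewrite RintegralB// RintegralB// fg// opprD opprK; congr (_ + _).
have [ckphi _] := tphi; have [ckdphi _] := tdphi.
rewrite (integration_by_parts_test (i := i) mO (ckphi 0%N) ((ckphi 1%N).2 i).1 (ckdphi 0%N) tchi).
by rewrite opprK.
Qed.

(* Test functions are dense in [H10], and both sides are continuous in the
   [H1] norm of [f]. *)
Lemma H10_integration_by_parts psi f i : H1 Omega psi -> H10 Omega f ->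
  \int[mu]_(x in Omega) (wpartial Omega i psi x * f x) =
  - \int[mu]_(x in Omega) (psi x * wpartial Omega i f x).
Proof.
move=> H1psi [H1f [phi [tphi cphi]]].
set g := wpartial Omega i psi; set w := wpartial Omega i f.
have [hg psig] : weak_partial_of Omega i psi g := H1_wpartial i H1psi.
have [hw fw] : weak_partial_of Omega i f w := H1_wpartial i H1f.
have hpsi := H1psi.1; have hf := H1f.1.
set X := \int[mu]_(x in Omega) (g x * f x); set Y := \int[mu]_(x in Omega) (psi x * w x).
set G := \int[mu]_(x in Omega) g x ^+ 2; set P := \int[mu]_(x in Omega) psi x ^+ 2.
have G0 : 0 <= G by apply: Rintegral_ge0 => x _; exact: sqr_ge0.
have P0 : 0 <= P by apply: Rintegral_ge0 => x _; exact: sqr_ge0.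
pose D n := H1norm Omega (f \- phi n).
(* The identity is exact for the test function [phi n], so [X + Y] does not change when [f] is
   replaced by [f \- phi n]. Cauchy-Schwarz on both terms and $(a+b)^2 \le 2(a^2+b^2)$ give the
   bound. *)
suff XY n : (X + Y) ^+ 2 <= (G + P) *+ 2 * D n ^+ 2.
  have : (X + Y) ^+ 2 <= (G + P) *+ 2 * 0 ^+ 2.
    apply: (@ler_cvg_to _ \oo _ _ (cst ((X + Y) ^+ 2)) (fun n => (G + P) *+ 2 * D n ^+ 2)).
    - exact: cvg_cst.
    - by apply: cvgM; [exact: cvg_cst|apply: cvgM; exact: cphi].
    - exact: nearW.
  rewrite expr0n mulr0 => XY0; apply/eqP; rewrite -addr_eq0 -sqrf_eq0.
  by rewrite eq_le XY0 sqr_ge0.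
have tdphi j := test_function_partial j (tphi n).
have hphi := L2_test_function mO (tphi n).
have hdphi j := L2_test_function mO (tdphi j).
set a := \int[mu]_(x in Omega) (g x * (f x - phi n x)).
set b := \int[mu]_(x in Omega) (psi x * (w x - partial i (phi n) x)).
have XYab : X + Y = a + b.
  have ag := L2M_integrable mO hg hf; have ap := L2M_integrable mO hg hphi.
  have bg := L2M_integrable mO hpsi hw; have bp := L2M_integrable mO hpsi (hdphi i).
  have -> : a = X - \int[mu]_(x in Omega) (g x * phi n x).
    by rewrite -RintegralB//; apply: eq_Rintegral => x _; rewrite mulrBr.
  have -> : b = Y - \int[mu]_(x in Omega) (psi x * partial i (phi n) x).
    by rewrite -RintegralB//; apply: eq_Rintegral => x _; rewrite mulrBr.
  by rewrite (psig _ (tphi n)); ring.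
pose S := \int[mu]_(x in Omega) (f x - phi n x) ^+ 2.
pose Sj j := \int[mu]_(x in Omega) wpartial Omega j (f \- phi n) x ^+ 2.
have S0 : 0 <= S by apply: Rintegral_ge0 => x _; exact: sqr_ge0.
have Sj0 j : 0 <= Sj j by apply: Rintegral_ge0 => x _; exact: sqr_ge0.
have SS : 0 <= \sum_j Sj j by apply: sumr_ge0 => j _; exact: Sj0.
have DE : D n ^+ 2 = S + \sum_j Sj j by exact: (sqr_sqrtr (addr_ge0 S0 SS)).
have SD : S <= D n ^+ 2 by rewrite DE lerDl; exact: SS.
have SiD : Sj i <= D n ^+ 2.
  rewrite DE (bigD1 i isT) addrCA lerDl; apply: (addr_ge0 S0).
  by apply: sumr_ge0 => j _; exact: Sj0.
have SiE : Sj i = \int[mu]_(x in Omega) (w x - partial i (phi n) x) ^+ 2.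
  have wB := weak_partialB_test hf (conj hw fw) (tphi n).
  have wB' : weak_partial_of Omega i (f \- phi n) (wpartial Omega i (f \- phi n)).
    by apply: xgetPex; eexists; exact: wB.
  apply: ae_eq_Rintegral => //.
  - exact: (L2M_integrable mO wB'.1 wB'.1).
  - exact: (L2M_integrable mO wB.1 wB.1).
  - by apply: filterS (weak_partial_unique wB' wB) => x h Ox; rewrite h.
have ha : a ^+ 2 <= G * D n ^+ 2.
  apply: (le_trans (cauchy_schwarz mO hg (L2B hf hphi))); exact: (ler_wpM2l G0 SD).
have hb : b ^+ 2 <= P * D n ^+ 2.
  apply: (le_trans (cauchy_schwarz mO hpsi (L2B hw (hdphi i)))).
  by rewrite -SiE; exact: (ler_wpM2l P0 SiD).
rewrite XYab; apply: (@le_trans _ _ ((a ^+ 2 + b ^+ 2) *+ 2)).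
  by rewrite -subr_ge0 (_ : _ - _ = (a - b) ^+ 2) ?sqr_ge0//; ring.
by rewrite mulrnAl mulrDl lerMn2r; apply/orP; right; exact: lerD ha hb.
Qed.

Lemma Rintegral_div_test v phi : L2v Omega v -> test_function Omega phi ->
  \int[mu]_(x in Omega) (\sum_(i < d) v x ord0 i * partial i phi x) =
  \sum_(i < d) \int[mu]_(x in Omega) (v x ord0 i * partial i phi x).
Proof.
move=> hv tphi; rewrite (Rintegral_sum _ (F := fun i x => v x ord0 i * partial i phi x))//.
by move=> i; apply: L2_test_integrable => //; exact: test_function_partial.
Qed.

Lemma weak_divD v w g h : L2v Omega v -> L2v Omega w ->
  weak_div_of Omega v g -> weak_div_of Omega w h ->
  weak_div_of Omega (v \+ w) (fun x => g x + h x).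
Proof.
move=> hv hw [hg vg] [hh wh]; split; first exact: L2D.
move=> phi tphi.
have ig := L2_test_integrable hg tphi; have ih := L2_test_integrable hh tphi.
have hvw : L2v Omega (v \+ w).
  move=> i; rewrite (_ : (fun x => _) = fun x => v x ord0 i + w x ord0 i).
    exact: L2D.
  by apply/funext => x; rewrite mxE.
under [in RHS]eq_Rintegral do rewrite mulrDl.
rewrite RintegralD// opprD -vg// -wh// !Rintegral_div_test// -big_split/=.
apply: eq_bigr => i _; have tdphi := test_function_partial i tphi.
rewrite -(RintegralD mO (L2_test_integrable (hv i) tdphi) (L2_test_integrable (hw i) tdphi)).
by apply: eq_Rintegral => x _; rewrite mxE mulrDl.
Qed.

Lemma H1_weak_div v : (forall i, H1 Omega (fun x => v x ord0 i)) ->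
  weak_div_of Omega v (fun x => \sum_(i < d) wpartial Omega i (fun y => v y ord0 i) x).
Proof.
move=> hv; have hw i := H1_wpartial i (hv i).
split; first by apply: L2_sum => i; exact: (hw i).1.
move=> phi tphi; rewrite Rintegral_div_test//; last by move=> i; exact: (hv i).1.
under [in RHS]eq_Rintegral do rewrite mulr_suml.
rewrite (Rintegral_sum _ (F := fun i x => wpartial Omega i (fun y => v y ord0 i) x * phi x))//.
  by rewrite -sumrN; apply: eq_bigr => i _; exact: (hw i).2.
by move=> i; apply: L2_test_integrable => //; exact: (hw i).1.
Qed.

(** Test functions of [U] are test functions of [Omega], so [g] is a weak divergence on [U] too.
    There [v] agrees with an affine field, whose classical divergence is the trace of [A]. *)
Lemma weak_div_affine (U : set E) v g (A : 'M[R]_d) (b : E) :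
  open U -> U `<=` Omega -> L2v Omega v -> weak_div_of Omega v g ->
  v = (fun x => x *m A + b) %[ae mu in U] -> g = cst (\tr A) %[ae mu in U].
Proof.
move=> oU UO hv [hg vg] vA; have mU := open_measurable_rV oU.
have bU : bounded_set U.
  by have [M [Mr OM]] := bO; exists M; split=> // r rM x /UO; exact: OM.
have SU (f : E -> R) : mu.-integrable Omega (EFin \o f) -> mu.-integrable U (EFin \o f).
  by move=> fi; apply: (integrableS mO mU UO).
have ig : mu.-integrable U (EFin \o g) by apply: SU; exact: L2_integrable.
have itr : mu.-integrable U (EFin \o cst (\tr A)).
  by apply: L2_integrable => //; exact: L2_cst.
have : (fun x => g x - \tr A) = cst 0 %[ae mu in U].
  apply: ae_eq0_test_function => // [|phi tphiU].
    exact: (integrableB mU ig itr).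
  have tphi := test_functionS UO tphiU.
  have [ck [K [cK KU phi0]]] := tphiU.
  have cK' : closed K by apply: compact_closed => //; exact: norm_hausdorff.
  have dphi0 i x : ~ U x -> partial i phi x = 0.
    move=> nUx; apply: (@partial_support _ _ i phi K) => //.
    by move=> /KU.
  have phiU x : ~ U x -> phi x = 0 by move=> nUx; apply: phi0 => /KU.
  have igphi := SU _ (L2_test_integrable hg tphi).
  have trL2 : L2 Omega (fun=> \tr A) by exact: L2_cst.
  have itphi := SU _ (L2_test_integrable trL2 tphi).
  under eq_Rintegral do rewrite mulrBl.
  rewrite (RintegralB mU igphi itphi).
  apply/eqP; rewrite subr_eq0; apply/eqP.
  rewrite -(Rintegral_supported UO) => [|x /phiU ->]; last by rewrite mulr0.
  apply: oppr_inj; rewrite -vg// Rintegral_div_test//.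
  transitivity (\sum_(i < d) - \int[mu]_(x in U) (A i i * phi x)).
    apply: eq_bigr => i _.
    rewrite (Rintegral_supported UO) => [|x /(dphi0 i) ->]; last by rewrite mulr0.
    rewrite -(integration_by_parts_affine A b i mU tphiU).
    have tdphiU := test_function_partial i tphiU.
    have tdphi := test_function_partial i tphi.
    apply: ae_eq_Rintegral => //.
    - exact: SU _ (L2_test_integrable (hv i) tdphi).
    - apply: (@integrableS _ _ _ mu setT) => //.
      apply: (compact_support_integrable cK).
        move=> x; apply: (cvgM (@continuous_affine_coord _ _ A b i x)).
        by have [ckd _] := tdphi; exact: (ckd 0%N).
      by move=> x Kx; rewrite (partial_support i cK' phi0)// mulr0.
    - by apply: filterS vA => x vx Ux; rewrite vx.
  rewrite sumrN; congr (- _).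
  rewrite -(Rintegral_sum _ (F := fun i x => A i i * phi x))// => [|i].
    by apply: eq_Rintegral => x _; rewrite -mulr_suml.
  have AL2 : L2 Omega (fun=> A i i) by exact: L2_cst.
  exact: SU _ (L2_test_integrable AL2 tphi).
by apply: filterS => x gx Ux; apply/eqP; rewrite -subr_eq0; apply/eqP; exact: gx.
Qed.

End weak_derivatives.

(** * Elements lie inside a Lipschitz domain *)

Section lipschitz_domains.
Context {R : realType} {d : nat}.
Local Notation E := 'rV[R]_d.
Implicit Types (Omega : set E) (x y e : E).

Lemma dotDl x y e : dot (x + y) e = dot x e + dot y e.
Proof. by rewrite /dot -big_split; apply: eq_bigr => i _; rewrite mxE mulrDl. Qed.

Lemma dotZl (a : R) x e : dot (a *: x) e = a * dot x e.
Proof. by rewrite /dot mulr_sumr; apply: eq_bigr => i _; rewrite mxE mulrA. Qed.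

Lemma continuous_enorm_affine (A : 'M[R]_d) (b : E) :
  continuous (fun x : E => enorm (x *m A + b)).
Proof.
have c : continuous (fun x : E => dot (x *m A + b) (x *m A + b)).
  apply: (@continuous_bigsum _ _ _ _
    (fun i x => (x *m A + b) ord0 i * (x *m A + b) ord0 i)) => i x.
  exact: (cvgM (@continuous_affine_coord _ _ A b i x) (@continuous_affine_coord _ _ A b i x)).
by move=> x; apply: (continuous_comp (c x)); exact: sqrt_continuous.
Qed.

(* A boundary point [x] interior to the closure could be moved slightly below
   the graph, off the closure. *)
Lemma lipschitz_interior_closure Omega : lipschitz_boundary Omega ->
  (closure Omega)° `<=` Omega.
Proof.
move=> lipO x xcO; apply: contrapT => nOx.
have [|e [g [L [e1 gL gO]]]] := lipO x.
  by split; [exact: interior_subset xcO|move=> /interior_subset].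
have ee : dot e e = 1.
  have ee0 : 0 <= dot e e by apply: sumr_ge0 => i _; rewrite -expr2 sqr_ge0.
  by rewrite -(sqr_sqrtr ee0) -/(enorm e) e1 expr1n.
pose p (z : E) := z - dot z e *: e.
(* The projection along [e] as a matrix, which makes the distance between projections a continuous
   function of [z]. *)
have pE z w : p z - p w = z *m (1%:M - e^T *m e) + (- (w *m (1%:M - e^T *m e))).
  have pM u : p u = u *m (1%:M - e^T *m e).
    rewrite mulmxBr mulmx1 mulmxA; congr (_ - _); apply/rowP => i.
    rewrite !mxE big_ord1 !mxE; congr (_ * _).
    by apply: eq_bigr => j _; rewrite mxE.
  by rewrite !pM.
have gx : dot x e <= g (p x).
  rewrite leNgt; apply/negP => /(nbhs_singleton gO).2; exact: nOx.
pose B := [set z | Omega z <-> g (p z) < dot z e] `&` closure Omega.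
have xB : nbhs x B by apply: filterI.
have [t [t0 tB]] : exists t : R, 0 < t /\ nbhs (x - t *: e) B.
  have ct : (fun t : R => x - t *: e) @ 0 --> x - 0 *: e.
    by apply: cvgB; [exact: cvg_cst|apply: cvgZr_tmp; exact: cvg_id].
  have : \forall t \near (0 : R), nbhs (x - t *: e) B.
    have xB' : nbhs (x - 0 *: e) (fun z => nbhs z B).
      by rewrite scale0r subr0; exact: nbhs_interior.
    exact: (ct _ xB').
  move=> /nbhs_ballP[r /= r0 rB]; exists (r / 2); split; first by rewrite divr_gt0.
  apply: rB; rewrite /ball /= sub0r normrN gtr0_norm ?divr_gt0//.
  by rewrite ltr_pdivrMr// ltr_pMr// ltr1n.
set y := x - t *: e in tB.
have ye : dot y e = dot x e - t by rewrite /y -scaleNr dotDl dotZl ee mulr1.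
have py : p y = p x.
  by rewrite /p ye /y scalerBl opprB addrA addrNK.
have yg : dot y e < g (p y) by rewrite ye py (lt_le_trans _ gx)// ltrBlDr ltrDl.
(* By the Lipschitz bound, [k z < g (p y)] puts [z] strictly below the graph, and it holds near [y].
   As [y] is in the closure, some such [z] lies in [Omega], hence above the graph: a
   contradiction. *)
pose k (z : E) := L * enorm (p z - p y) + dot z e.
have ck : k z @[z --> y] --> k y.
  pose k' z := L * enorm (z *m (1%:M - e^T *m e) + - (y *m (1%:M - e^T *m e))) + dot z e.
  have -> : k = k' by apply/funext => z; rewrite /k pE.
  exact: (cvgD (cvgM (cvg_cst L) (@continuous_enorm_affine _ _ y)) (@continuous_dotl _ _ e y)).
have ky : k y < g (p y).
  rewrite /k subrr /enorm /dot big1 ?sqrtr0 ?mulr0 ?add0r// => i _.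
  by rewrite mxE mul0r.
have kz : \forall z \near y, k z < g (p y) by exact: (cvgr_lt _ ck).
have [_ ycO] := nbhs_singleton tB.
have [z [Oz [kzy [/= /iffLR/(_ Oz) gz _]]]] := ycO _ (filterI kz tB).
have := gL (p z) (p y); rewrite distrC => /(le_trans (ler_norm _)) gyz.
by move: kzy; rewrite /k => kzy; exfalso; lra.
Qed.

(** The simplices cover only the closure, so an open element lies in the interior of the closure. On
    a slit domain that set is larger than [Omega]; a Lipschitz boundary rules this out. *)
Lemma elem_subset Omega (M : mesh R d) T : lipschitz_boundary Omega ->
  triangulation Omega M -> T \in cells M -> elem T `<=` Omega.
Proof.
move=> lipO [_ _ cO _] TM; apply: subset_trans (lipschitz_interior_closure lipO).
by apply: interiorS; rewrite cO; exact: bigcup_sup.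
Qed.

End lipschitz_domains.

(** * The discrete Stokes problem *)

Section stokes.
Context {R : realType} {d : nat} (Omega : set 'rV[R]_d) (M : mesh R d).
Hypothesis domO : polyhedral_lipschitz_domain Omega.
Hypothesis triO : triangulation Omega M.
Local Notation E := 'rV[R]_d.
Local Notation mu := (@lebesgue_rV R d).
Implicit Types (v : E -> E) (psi q : E -> R).

Let oO : open Omega. Proof. by case: domO => -[]. Qed.
Let bO : bounded_set Omega. Proof. by case: domO => -[]. Qed.
Let lO : lipschitz_boundary Omega. Proof. by case: domO => _ []. Qed.
Let mO : measurable Omega. Proof. exact: open_measurable_rV. Qed.

Lemma L2v_add v w : L2v Omega v -> L2v Omega w -> L2v Omega (v \+ w).
Proof.
move=> hv hw i; rewrite (_ : (fun x => _) = fun x => v x ord0 i + w x ord0 i).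
  exact: L2D.
by apply/funext => x; rewrite mxE.
Qed.

Lemma V_L2v v : V Omega v -> L2v Omega v.
Proof. by move=> Vv i; have [[]] := Vv i. Qed.

Lemma Vh_L2v v : Vh Omega M v -> L2v Omega v.
Proof.
by move=> [v1 [vR [[/V_L2v h1 _] [[[hR _] _] _] ->]]]; exact: L2v_add.
Qed.

Lemma Vh_weak_div v : Vh Omega M v -> exists g, weak_div_of Omega v g.
Proof.
move=> [v1 [vR [[V1 _] [[[hR [g vg]] _] _] ->]]].
have h1 : weak_div_of Omega v1 _ := H1_weak_div oO (fun i => (V1 i).1).
by eexists; exact: (weak_divD oO (V_L2v V1) hR h1 vg).
Qed.

(** On an element the two parts add up to the affine field $x (A + c I) + (b + a)$, so the constant
    is the trace of $A + c I$. *)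
Lemma Vh_wdiv_cst v T : Vh Omega M v -> T \in cells M ->
  exists c : R, wdiv Omega v = cst c %[ae mu in elem T].
Proof.
move=> hv TM; have [v1 [vR [[V1 v1T] [[[hR _] _] vRT] vE]]] := hv.
have [A [b v1A]] := v1T T TM; have [a [c vRa]] := vRT T TM.
exists (\tr (A + c%:M)); apply: (@weak_div_affine R d Omega oO bO _ v _ _ (b + a)).
- exact: open_interior.
- exact: (elem_subset lO triO TM).
- exact: Vh_L2v.
- exact: (xgetPex (cst 0) (Vh_weak_div hv)).
- apply: filterS2 v1A vRa => x h1 hR' Tx.
  rewrite vE /= h1// hR'// mulmxDr mul_mx_scalar -!addrA; congr (_ + _).
  by rewrite [RHS]addrCA [c *: x + a]addrC.
Qed.

Lemma dot_wgrad_integrable psi v i : H1 Omega psi -> L2v Omega v ->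
  mu.-integrable Omega (EFin \o (fun x => wpartial Omega i psi x * v x ord0 i)).
Proof.
by move=> H1psi hv; apply: (L2M_integrable mO) => //; exact: (H1_wpartial i H1psi).1.
Qed.

Lemma dot_wgradE psi v x :
  dot (wgrad Omega psi x) (v x) = \sum_i wpartial Omega i psi x * v x ord0 i.
Proof. by apply: eq_bigr => i _; rewrite mxE. Qed.

Lemma wgrad_integrable psi v : H1 Omega psi -> L2v Omega v ->
  mu.-integrable Omega (EFin \o (fun x => dot (wgrad Omega psi x) (v x))).
Proof.
move=> H1psi hv.
rewrite (_ : _ \o _ = fun x => (\sum_i (wpartial Omega i psi x * v x ord0 i)%:E)%E).
  by apply: integrable_sum => // i _; exact: dot_wgrad_integrable.
by apply/funext => x; rewrite /= dot_wgradE sumEFin.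
Qed.

Lemma Rintegral_wgrad psi v : H1 Omega psi -> L2v Omega v ->
  \int[mu]_(x in Omega) dot (wgrad Omega psi x) (v x) =
  \sum_i \int[mu]_(x in Omega) (wpartial Omega i psi x * v x ord0 i).
Proof.
move=> H1psi hv; under eq_Rintegral do rewrite dot_wgradE.
rewrite (Rintegral_sum _ (F := fun i x => wpartial Omega i psi x * v x ord0 i))//.
by move=> i; exact: dot_wgrad_integrable.
Qed.

Lemma Vh_green psi v : H1 Omega psi -> Vh Omega M v ->
  \int[mu]_(x in Omega) dot (wgrad Omega psi x) (v x) =
  - \int[mu]_(x in Omega) (psi x * wdiv Omega v x).
Proof.
move=> H1psi hv; have [v1 [vR [[V1 _] [[[hR [g0 vg0]] vR0] _] vE]]] := hv.
have h1 := V_L2v V1; have hpsi := H1psi.1.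
pose w i := wpartial Omega i (fun y => v1 y ord0 i).
have hw i : L2 Omega (w i) := (H1_wpartial i (V1 i).1).1.
have gR : weak_div_of Omega vR (wdiv Omega vR) by apply: (xgetPex (cst 0)); exists g0.
have hgR := gR.1; have g1 : weak_div_of Omega v1 _ := H1_weak_div oO (fun i => (V1 i).1).
have hg1 := g1.1.
have gv := weak_divD oO h1 hR g1 gR.
have iD1 := L2M_integrable mO hpsi hg1; have iDR := L2M_integrable mO hpsi hgR.
(* [wdiv] of the sum is chosen independently of the divergences of the two parts, so the splitting
   holds only almost everywhere. *)
have -> : \int[mu]_(x in Omega) (psi x * wdiv Omega v x) =
    \int[mu]_(x in Omega) (psi x * \sum_i w i x) +
    \int[mu]_(x in Omega) (psi x * wdiv Omega vR x).
  rewrite -(RintegralD mO iD1 iDR).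
  apply: ae_eq_Rintegral => //.
  - exact: (L2M_integrable mO hpsi (L2_wdiv (Vh_weak_div hv))).
  - exact: (integrableD mO iD1 iDR).
  - rewrite -vE in gv; apply: filterS (wdiv_ae_eq oO bO gv) => x gx Ox.
    by rewrite -mulrDr; congr (_ * _); exact: gx.
have -> : \int[mu]_(x in Omega) dot (wgrad Omega psi x) (v x) =
    \int[mu]_(x in Omega) dot (wgrad Omega psi x) (v1 x) +
    \int[mu]_(x in Omega) dot (wgrad Omega psi x) (vR x).
  rewrite -(RintegralD mO (wgrad_integrable H1psi h1) (wgrad_integrable H1psi hR)).
  apply: eq_Rintegral => x _; rewrite vE !dot_wgradE -big_split /=.
  by apply: eq_bigr => i _; rewrite mxE mulrDr.
rewrite opprD; congr (_ + _).
  rewrite Rintegral_wgrad//.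
  transitivity (\sum_i - \int[mu]_(x in Omega) (psi x * w i x)).
    by apply: eq_bigr => i _; exact: (H10_integration_by_parts oO bO i H1psi (V1 i)).
  rewrite sumrN; congr (- _).
  rewrite -(Rintegral_sum _ (F := fun i x => psi x * w i x))//.
    by apply: eq_Rintegral => x _; rewrite -mulr_sumr.
  by move=> i; exact: (L2M_integrable mO hpsi (hw i)).
have := vR0 psi H1psi; rewrite /normal_trace => /eqP; rewrite addr_eq0 => /eqP.
rewrite (_ : Rintegral _ _ _ = \int[mu]_(x in Omega) dot (wgrad Omega psi x) (vR x)).
  by move=> ->; congr (- _); apply: eq_Rintegral => x _; rewrite mulrC.
by apply: eq_Rintegral => x _; apply: eq_bigr => i _; rewrite mulrC.
Qed.

(* [wdiv v] minus its mean belongs to [Wh]; the constant is harmless because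
   [psi] and its projection both have zero mean. *)
Lemma L2_projection_wdiv psi Ppsi v : L20 Omega psi -> L2_projection Omega M psi Ppsi ->
  Vh Omega M v ->
  \int[mu]_(x in Omega) (psi x * wdiv Omega v x) = form_b Omega v Ppsi.
Proof.
move=> [hpsi psi0] [[[hP P0] _] proj] hv.
have hg := L2_wdiv (Vh_weak_div hv); set g := wdiv Omega v in hg *.
have h1 : L2 Omega (fun=> 1) by exact: L2_cst.
pose m := fine (mu Omega).
pose c := (\int[mu]_(x in Omega) g x) / m.
have hc : L2 Omega (fun=> c) by exact: L2_cst.
have ig := L2_integrable mO bO hg; have ic := L2_integrable mO bO hc.
have Wq : Wh Omega M (fun x => g x - c).
  split; last first.
    move=> T TM; have [k gk] := Vh_wdiv_cst hv TM; exists (k - c).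
    by apply: filterS gk => x gx Tx; rewrite /g gx.
  split; first exact: (L2B hg hc).
  rewrite (RintegralB mO ig ic) (Rintegral_cst mu mO).
  (* If [m] is 0, the division by [m] says nothing about [c]; the mean then vanishes because [Omega]
     is a null set, its measure being finite. *)
  have [m0|m0] := eqVneq m 0; last by rewrite /c divfK ?subrr.
  rewrite -/m m0 mulr0 subr0 /Rintegral null_set_integral//.
    exact: measurable_int ig.
  apply/eqP; rewrite -fine_eq0; first exact/eqP.
  by rewrite ge0_fin_numE//; exact: bounded_lebesgue_rV_lty.
have ihP := L2_integrable mO bO hP; have ihpsi := L2_integrable mO bO hpsi.
have ipg := L2M_integrable mO hpsi hg; have iPg := L2M_integrable mO hP hg.
have ipc := L2M_integrable mO hpsi hc; have iPc := L2M_integrable mO hP hc.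
have := proj _ Wq.
rewrite (_ : Rintegral _ _ _ =
    (\int[mu]_(x in Omega) (psi x * g x) - \int[mu]_(x in Omega) (Ppsi x * g x)) -
    (\int[mu]_(x in Omega) (psi x * c) - \int[mu]_(x in Omega) (Ppsi x * c))).
  rewrite (RintegralZr _ mO ihpsi) (RintegralZr _ mO ihP) psi0 P0 mul0r subr0 subr0.
  move=> /eqP; rewrite subr_eq0 => /eqP ->.
  by apply: eq_Rintegral => x _; rewrite mulrC.
rewrite -(RintegralB mO ipg iPg) -(RintegralB mO ipc iPc).
rewrite -(RintegralB mO (integrableB mO ipg iPg) (integrableB mO ipc iPc)).
by apply: eq_Rintegral => x _; ring.
Qed.

Variables (alpha : {set 'I_(nnode M)} -> R)
  (Phi : {set 'I_(nnode M)} -> E -> E) (s : stabilization) (nu : R).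

Lemma form_bD v p q : Vh Omega M v -> L2 Omega p -> L2 Omega q ->
  form_b Omega v (fun x => p x + q x) = form_b Omega v p + form_b Omega v q.
Proof.
move=> hv hp hq; have hg := L2_wdiv (Vh_weak_div hv).
rewrite /form_b -(RintegralD mO (L2M_integrable mO hg hp) (L2M_integrable mO hg hq)).
by apply: eq_Rintegral => x _; rewrite mulrDr.
Qed.

Lemma Wh_lincomb (k : R) p q : Wh Omega M p -> Wh Omega M q ->
  Wh Omega M (fun x => p x + k * q x).
Proof.
move=> [[hp p0] pT] [[hq q0] qT]; split.
  split; first exact: (L2D hp (L2Z k hq)).
  have ip := L2_integrable mO bO hp; have iq := L2_integrable mO bO hq.
  rewrite (RintegralD mO ip (L2_integrable mO bO (L2Z k hq))) (RintegralZl k mO iq).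
  by rewrite p0 q0 mulr0 addr0.
move=> T TM; have [a pa] := pT T TM; have [b qb] := qT T TM.
exists (a + k * b); apply: filterS2 pa qb => x pa qb Tx.
by rewrite pa// qb.
Qed.

(** The pressure term changes by $-k\, b(v, P\psi) = k (\nabla\psi, v)$, exactly the change of the
    data. The factor [k] lets the same statement undo a shift, with $k = -1$. *)
Lemma stokes_solution_shift (k : R) psi Ppsi f u p :
  L2v Omega f -> H1 Omega psi -> L20 Omega psi ->
  L2_projection Omega M psi Ppsi ->
  stokes_solution Omega alpha Phi s nu f u p ->
  stokes_solution Omega alpha Phi s nu (fun x => f x + k *: wgrad Omega psi x) u
    (fun x => p x + k * Ppsi x).
Proof.
move=> hf H1psi psi0 projP [Vu Wp uv ub].
have [WP _] := projP; split=> //; first exact: Wh_lincomb.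
move=> v hv.
have hkP : L2 Omega (fun x => k * Ppsi x) by apply: L2Z; exact: WP.1.1.
rewrite form_bD//; last exact: Wp.1.1.
have hg := L2_wdiv (Vh_weak_div hv).
have -> : form_b Omega v (fun x => k * Ppsi x) = k * form_b Omega v Ppsi.
  rewrite /form_b -(RintegralZl k mO (L2M_integrable mO hg WP.1.1)).
  by apply: eq_Rintegral => x _; rewrite mulrCA.
have hL2 := Vh_L2v hv; have iw := wgrad_integrable H1psi hL2.
have if_ : mu.-integrable Omega (EFin \o (fun x => dot (f x) (v x))).
  rewrite (_ : _ \o _ = fun x => (\sum_i (f x ord0 i * v x ord0 i)%:E)%E).
    by apply: integrable_sum => // i _; exact: (L2M_integrable mO (hf i) (hL2 i)).
  by apply/funext => x; rewrite /= sumEFin.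
have -> : \int[mu]_(x in Omega) dot (f x + k *: wgrad Omega psi x) (v x) =
    \int[mu]_(x in Omega) dot (f x) (v x) +
    k * \int[mu]_(x in Omega) dot (wgrad Omega psi x) (v x).
  rewrite -(RintegralZl k mO iw) -(RintegralD mO if_ (integrableZl mO k iw)).
  by apply: eq_Rintegral => x _; rewrite dotDl dotZl.
rewrite (Vh_green H1psi hv) (L2_projection_wdiv psi0 projP hv) -uv//.
by rewrite mulrN opprD addrA.
Qed.

End stokes.

Theorem theorem2p2 (R : realType) (d : nat) (Hd : d = 2%N \/ d = 3%N)
  (Omega : set 'rV[R]_d) (HOmega : polyhedral_lipschitz_domain Omega)
  (M : mesh R d) (HM : triangulation Omega M)
  (sigma : R) (Hsigma : shape_regular M sigma)
  (nu : R) (Hnu : 0 < nu)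
  (alpha : {set 'I_(nnode M)} -> R)
  (Halpha : forall T, T \in cells M -> 0 < alpha T)
  (Phi : {set 'I_(nnode M)} -> 'rV[R]_d -> 'rV[R]_d)
  (HPhi : forall e, e \in interior_faces M ->
     RT0_basis_function Omega e (Phi e))
  (s : stabilization)
  (f : 'rV[R]_d -> 'rV[R]_d) (Hf : L2v Omega f)
  (psi : 'rV[R]_d -> R) (Hpsi : H1 Omega psi) (Hpsi0 : L20 Omega psi)
  (Ppsi : 'rV[R]_d -> R) (HPpsi : L2_projection Omega M psi Ppsi)
  (u : 'rV[R]_d -> 'rV[R]_d) (p : 'rV[R]_d -> R) :
  let f' := fun x => f x + wgrad Omega psi x in
  let p' := fun x => p x + Ppsi x in
  (stokes_solution Omega alpha Phi s nu f u p ->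
   stokes_solution Omega alpha Phi s nu f' u p') /\
  (stokes_unique_solution Omega alpha Phi s nu f u p ->
   stokes_unique_solution Omega alpha Phi s nu f' u p').
Proof.
move=> f' p'.
have f'E : f' = fun x => f x + 1 *: wgrad Omega psi x.
  by apply/funext => x; rewrite scale1r.
have p'E : p' = fun x => p x + 1 * Ppsi x by apply/funext => x; rewrite mul1r.
have shift : stokes_solution Omega alpha Phi s nu f u p ->
    stokes_solution Omega alpha Phi s nu f' u p'.
  by rewrite f'E p'E; exact: (stokes_solution_shift HOmega HM 1).
split=> // -[sol uniq]; split; first exact: shift.
have hf' : L2v Omega f'.
  have mO : measurable Omega by case: HOmega => -[oO _ _ _] _; exact: open_measurable_rV.
  move=> i; rewrite (_ : (fun x => _) = fun x => f x ord0 i + wpartial Omega i psi x).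
    exact: (L2D (Hf i) (H1_wpartial i Hpsi).1).
  by apply/funext => x; rewrite !mxE.
move=> u' q sol'.
(* Any competitor for the data [f'] is shifted back to a solution for [f], where uniqueness is
   assumed. *)
have := stokes_solution_shift HOmega HM (-1) hf' Hpsi Hpsi0 HPpsi sol'.
have -> : (fun x => f' x + -1 *: wgrad Omega psi x) = f.
  by apply/funext => x; rewrite /f' scaleN1r addrK.
move=> /uniq[uu' qp]; split=> //.
by apply: filterS qp => x qp Ox; rewrite /p' -qp// mulN1r addrNK.
Qed.
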